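(* Let $\mathcal{H}$ be a separable infinite-dimensional Hilbert space and let $S\in L(\mathcal{H})$ be a bounded selfadjoint operator. Then, for every $k\in\mathbb{N}$, 1. $U_k(S)=U_k(S^+)+k\,\alpha^+(S)$, 2. $L_k(S)=L_k(S_-)+k\,\alpha_-(S)$. In particular, $$\lim_{k\to\infty}\frac{U_k(S)}{k}=\alpha^+(S)=\|S\|_e\quad\text{and}\quad \lim_{k\to\infty}\frac{L_k(S)}{k}=\alpha_-(S).$$
   Context: Hilbert spaces are complex; $\mathbb{N}=\{1,2,\dots\}$; $L(\mathcal{H})$ is the algebra of bounded linear operators on $\mathcal{H}$. For selfadjoint $A\in L(\mathcal{H})$ and $k\in\mathbb{N}$, let $\mathcal{P}_k$ be the set of orthogonal projections onto $k$-dimensional subspaces of $\mathcal{H}$, and put $U_k(A)=\sup_{P\in\mathcal{P}_k}\operatorname{tr}(AP)$, $L_k(A)=\inf_{P\in\mathcal{P}_k}\operatorname{tr}(AP)$. $\sigma_e(S)$ is the essential spectrum of $S$, i.e. the spectrum of the class of $S$ in the Calkin algebra $L(\mathcal{H})/L_0(\mathcal{H})$, where $L_0(\mathcal{H})$ is the ideal of compact operators. The essential norm is $\|S\|_e=\inf\{\|S+K\|: K\in L_0(\mathcal{H})\}$, the quotient norm of the class of $S$ in the Calkin algebra. Put $\alpha^+(S)=\max\sigma_e(S)$ (which the source also writes as $\|S\|_e$ in its definition) and $\alpha_-(S)=\min\sigma_e(S)$. If $E$ is the spectral measure of $S$, so $S=\int_{\sigma(S)}t\,dE(t)$, put $$S^+=\int_{[\alpha^+(S),\,\|S\|]}(t-\alpha^+(S))\,dE(t),\qquad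 S_-=\int_{[-\|S\|,\,\alpha_-(S)]}(t-\alpha_-(S))\,dE(t).$$ These are compact operators with $S_-\le 0\le S^+$.
   Formalization: The equality α^+(S)=‖S‖_e fails for general selfadjoint S (for S=−I, α^+(S)=−1 but ‖S‖_e=1); it is replaced by: α^+(S)=‖S‖_e if and only if −α_-(S) ≤ α^+(S). *)

(* Defs.v *)
From HB Require Import structures.
From mathcomp Require Import all_boot all_order all_algebra.
From mathcomp Require Import complex.
From mathcomp Require Import all_classical all_reals all_analysis.

Set Implicit Arguments.
Unset Strict Implicit.
Unset Printing Implicit Defensive.

Import Order.TTheory GRing.Theory Num.Theory.
Import numFieldNormedType.Exports.

Local Open Scope classical_set_scope.
Local Open Scope ring_scope.
Local Open Scope complex_scope.

(* [inner] is linear in its first argument and conjugate-linear in its second. *)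
HB.mixin Record CompleteNormedModule_isHilbert (R : realType) H
    & CompleteNormedModule R[i] H := {
  inner : {dot H for (@Num.conj R[i])};
  innerE : forall x : H, inner x x = `|x| ^+ 2
}.

#[short(type="hilbertType")]
HB.structure Definition Hilbert (R : realType) :=
  { H of CompleteNormedModule_isHilbert R H & CompleteNormedModule R[i] H }.

Section Bases.
Context {R : realType} {H : hilbertType R}.
Implicit Types (V : set H) (e : nat -> H).

Definition has_dim (n : nat) V :=
  exists v : 'I_n -> H,
    (forall c : 'I_n -> R[i],
       \sum_(i < n) c i *: v i = 0 -> forall i, c i = 0) /\
    V = [set x | exists c : 'I_n -> R[i], x = \sum_(i < n) c i *: v i].

Definition orthonormal_basis e :=
  (forall i j, inner (e i) (e j) = (i == j)%:R) /\
  (forall x, (forall i, inner x (e i) = 0) -> x = 0).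

End Bases.

Definition separable_hilbert (R : realType) (H : hilbertType R) :=
  exists2 D : set H, countable D & dense D.

Definition infinite_dimensional (R : realType) (H : hilbertType R) :=
  forall n, ~ has_dim n [set: H].

(* L(H): a linear map is bounded iff it is continuous. *)
Record bounded_op (R : realType) (H : hilbertType R) := BoundedOp {
  bop_fun :> {linear H -> H};
  bop_continuous : continuous bop_fun }.

HB.instance Definition _ (R : realType) (H : hilbertType R) :=
  gen_eqMixin (bounded_op H).
HB.instance Definition _ (R : realType) (H : hilbertType R) :=
  gen_choiceMixin (bounded_op H).

Section Operators.
Context {R : realType} {H : hilbertType R}.
Implicit Types (f : H -> H) (S T A P K : bounded_op H) (l : R[i]) (k : nat).

Definition bop0 : bounded_op H :=
  @BoundedOp R H (\0 : {linear H -> H}) (@cst_continuous H H 0).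

Definition selfadjoint A := forall x y, inner (A x) y = inner x (A y).

(* The norm of H is R[i]-valued, with nonnegative real values. *)
Definition op_norm f : R := sup [set complex.Re `|f x| | x in [set x | `|x| <= 1]].

Definition compact_op K := precompact (K @` [set x | `|x| <= 1]).

Definition spectrum S : set R[i] :=
  [set l | ~ exists T, (forall x, T (S x - l *: x) = x) /\
                       (forall x, S (T x) - l *: T x = x)].

(* Two operators have the same class in the Calkin algebra iff they differ by
   a compact one; [T] represents the inverse of the class of [S - l]. *)
Definition essential_spectrum S : set R[i] :=
  [set l | ~ exists T,
     (exists2 K, compact_op K & forall x, T (S x - l *: x) - x = K x) /\
     (exists2 K, compact_op K & forall x, S (T x) - l *: T x - x = K x)].

Definition essential_norm S : R :=
  inf [set op_norm (S \+ K) | K in compact_op].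

(* The order of R[i] is the partial one: z <= w means that w - z is a
   nonnegative real. *)
Definition is_max (A : set R[i]) (a : R) :=
  A a%:C /\ forall z, A z -> z <= a%:C.
Definition is_min (A : set R[i]) (a : R) :=
  A a%:C /\ forall z, A z -> a%:C <= z.

Definition alpha_plus S : R := xget 0 (is_max (essential_spectrum S)).
Definition alpha_minus S : R := xget 0 (is_min (essential_spectrum S)).

Definition orthogonal_projection P :=
  (forall x, P (P x) = P x) /\ selfadjoint P.

Definition projections k : set (bounded_op H) :=
  [set P | orthogonal_projection P /\ has_dim k (range P)].

(* Meant for trace class operators on a separable infinite-dimensional H. *)
Definition trace f : R[i] :=
  xget 0 [set z : R[i] | forall e : nat -> H, orthonormal_basis e ->
    (fun n => \sum_(i < n) inner (f (e i)) (e i)) @ \oo --> (z : R[i]^o)].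

(* tr (A P) is real for selfadjoint [A]. *)
Definition U k A : R := sup [set complex.Re (trace (A \o P)) | P in projections k].
Definition L k A : R := inf [set complex.Re (trace (A \o P)) | P in projections k].

End Operators.

(* Projection-valued measures on the Borel sets of R, countably additive in the
   strong operator topology. *)
Record spectral_measure (R : realType) (H : hilbertType R) := SpectralMeasure {
  sm_proj :> set R -> bounded_op H;
  sm_projP : forall A, measurable A -> orthogonal_projection (sm_proj A);
  sm_set0 : forall x, sm_proj set0 x = 0;
  sm_setT : forall x, sm_proj setT x = x;
  sm_setI : forall A B, measurable A -> measurable B ->
    forall x, sm_proj (A `&` B) x = sm_proj A (sm_proj B x);
  sm_sigma_additive : forall F : nat -> set R,
    (forall i, measurable (F i)) -> trivIset setT F ->
    forall x, (fun n => \sum_(0 <= i < n) sm_proj (F i) x) @ \oo -->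
              sm_proj (\bigcup_i F i) x }.

Section Inner_product.
Context {R : realType} {H : hilbertType R}.
Implicit Types x y : H.

Lemma CauchySchwarz_hilbert x y : `|inner x y| <= `|x| * `|y|.
Proof.
have [->|y0] := eqVneq y 0; first by rewrite linear0r !normr0 mulr0.
have ny : 0 < inner y y by rewrite innerE exprn_gt0 ?normr_gt0.
rewrite -(@ler_pXn2r _ 2) ?nnegrE ?mulr_ge0// exprMn -!innerE.
have: 0 <= inner (x - (inner x y / inner y y) *: y) (x - (inner x y / inner y y) *: y).
  by rewrite innerE exprn_ge0.
set c := _ / _; rewrite dnormB dnormZ linearZr_LR/=.
have cE : c^* * inner x y = `|inner x y| ^+ 2 / inner y y.
  by rewrite /c normCK rmorphM fmorphV/= (geC0_conj (ltW ny)) mulrAC [_^* * _]mulrC.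
rewrite cE rmorphM rmorphXn/= fmorphV/= (geC0_conj (ltW ny)) (geC0_conj (normr_ge0 _)).
have -> : `|c| ^+ 2 * inner y y = `|inner x y| ^+ 2 / inner y y.
  rewrite /c normf_div (ger0_norm (ltW ny)) expr_div_n expr2 invfM mulrA.
  by rewrite -!mulrA mulVf ?mulr1 ?gt_eqF// mulrA.
by rewrite opprD addrA addrK subr_ge0 ler_pdivrMr.
Qed.

Lemma Re_inner_continuous y : continuous (fun x => complex.Re (inner x y)).
Proof.
move=> x; apply/cvgrPdist_lt => e e0.
have y1 : 0 < `|y| + 1 by rewrite ltr_wpDl.
near=> z.
have : `|x - z| < e%:C / (`|y| + 1).
  near: z; apply: (proj1 (@cvgrPdist_lt _ _ _ (nbhs x) _ id x) _).
    exact: cvg_id.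
  by rewrite divr_gt0// ltcE/= eqxx.
rewrite ltr_pdivlMr// => xz.
have -> : complex.Re (inner x y) - complex.Re (inner z y) = complex.Re (inner (x - z) y).
  by rewrite linearBl; exact: (esym (raddfB (@complex.Re R : {additive Rcomplex R -> R}) _ _)).
have : `|complex.Re (inner (x - z) y)|%:C < e%:C.
  apply: le_lt_trans (normc_ge_Re _) _.
  apply: le_lt_trans (CauchySchwarz_hilbert _ _) (le_lt_trans _ xz).
  by rewrite ler_wpM2l// lerDl.
by rewrite ltcE/= eqxx.
Unshelve. all: by end_near. Qed.

End Inner_product.

Section Scalar_measures.
Context {R : realType} {H : hilbertType R} (E : spectral_measure H) (x : H).

(* The measure E_(x,x) = <E(.) x, x>; off the Borel sets, where [E] is
   unspecified, the value is set to 0. *)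
Definition scalar_measure (A : set R) : \bar R :=
  if `[< measurable A >] then (complex.Re (inner (E A x) x))%:E else 0%E.

Lemma scalar_measureE A : measurable A ->
  scalar_measure A = (complex.Re (inner (E A x) x))%:E.
Proof. by move=> mA; rewrite /scalar_measure asboolT. Qed.

Let inner_proj A : measurable A -> inner (E A x) x = `|E A x| ^+ 2.
Proof.
by move=> mA; have [idE saE] := sm_projP E mA; rewrite -innerE -saE idE.
Qed.

Let scalar_measure0 : scalar_measure set0 = 0%E.
Proof. by rewrite scalar_measureE// sm_set0 linear0l. Qed.

Let scalar_measure_ge0 A : (0 <= scalar_measure A)%E.
Proof.
rewrite /scalar_measure; case: ifPn => [/asboolP mA|//].
have : 0 <= inner (E A x) x by rewrite inner_proj// exprn_ge0.
by rewrite lee_fin; case: (inner _ _) => a b; rewrite lecE /= => /andP[].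
Qed.

Let scalar_measure_sigma_additive : semi_sigma_additive scalar_measure.
Proof.
move=> F mF tF mUF; rewrite scalar_measureE//.
under eq_fun do rewrite (eq_bigr (fun i => (complex.Re (inner (E (F i) x) x))%:E)
  (fun i _ => scalar_measureE (mF i))) sumEFin.
apply: cvg_EFin; first exact: nearW.
have -> : fine \o (fun n => (\sum_(0 <= i < n) complex.Re (inner (E (F i) x) x))%:E)
  = fun n => complex.Re (inner (\sum_(0 <= i < n) E (F i) x) x).
  apply/funext => n /=; elim: n => [|n IHn]; first by rewrite !big_nil linear0l.
  by rewrite !big_nat_recr//= linearDl IHn;
    exact: (esym (raddfD (@complex.Re R : {additive Rcomplex R -> R}) _ _)).
pose g (u : H) : R := complex.Re (inner u x).
have EF := @sm_sigma_additive _ _ E F mF tF x.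
exact: (@cvg_comp _ _ _ _ g _ _ _ EF (@Re_inner_continuous _ _ x _)).
Qed.

HB.instance Definition _ := isMeasure.Build _ _ R scalar_measure
  scalar_measure0 scalar_measure_ge0 scalar_measure_sigma_additive.

End Scalar_measures.

Section Spectral_integrals.
Context {R : realType} {H : hilbertType R}.
Implicit Types (S T : bounded_op H) (E : spectral_measure H) (D : set R).

(* T = \int_D f dE, in the weak sense. *)
Definition is_spectral_integral E D (f : R -> R) T :=
  forall x, inner (T x) x = (\int[scalar_measure E x]_(t in D) f t)%:C.

Definition spectral_integral E D (f : R -> R) : bounded_op H :=
  xget bop0 (is_spectral_integral E D f).

Definition is_spectral_measure_of S E :=
  let sigma := [set t : R | spectrum S t%:C] in
  (forall x, E sigma x = x) /\ is_spectral_integral E sigma id S.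

Definition upper_part S E : bounded_op H :=
  spectral_integral E `[alpha_plus S, op_norm S]
    (fun t => t - alpha_plus S).
Definition lower_part S E : bounded_op H :=
  spectral_integral E `[- op_norm S, alpha_minus S]
    (fun t => t - alpha_minus S).

End Spectral_integrals.

(* Main.v *)
Require Import Defs.
From HB Require Import structures.
From mathcomp Require Import all_boot all_order all_algebra.
From mathcomp Require Import complex ring lra.
From mathcomp Require Import all_classical all_reals all_analysis.
From mathcomp Require Import measurable_realfun.

Set Implicit Arguments.
Unset Strict Implicit.
Unset Printing Implicit Defensive.

Import Order.TTheory GRing.Theory Num.Theory.
Import numFieldNormedType.Exports.

Local Open Scope classical_set_scope.
Local Open Scope ring_scope.

(** Courant-Fischer: let [a] be the infimum, over all finite sets [s] of vectors,
    of the supremum of the quadratic form [<S x, x>] over unit vectors [x]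
    orthogonal to [s]. Outside finitely many dimensions the form is at most
    [a + e], while unit vectors orthogonal to any given finite set nearly attain
    [a]. Cauchy-Schwarz for the form turns the latter into Weyl vectors for [a], so
    [a] lies in the essential spectrum; for [r > a] the operator [r - S] becomes
    coercive after adding a multiple of a finite-rank projection, so [a] is the
    maximum. The trace formula [tr (A P) = sum_i <A f_i, f_i>], for an orthonormal
    basis [f] of the range of [P], then gives [U_k(S) / k --> a], and compressing
    [S] to the complement of a finite-dimensional space gives the essential norm.

    For the exact formula let [P = E([a, |S|])]. Since [S - a <= S^+], one
    inequality is immediate. Conversely, given orthonormal [f_1, ..., f_k], replace
    the components [(1 - P) f_i] by their image under an isometry into a span of
    Weyl vectors for [a] orthogonal to all [P f_i] and [S P f_i]: the new family is
    still orthonormal, and its sum of [<S h_i, h_i>] is at least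
    [sum_i <S^+ f_i, f_i> + k a] up to an arbitrarily small error. The statements
    about [L_k] and [alpha_-] are those for [- S]. *)

(** * Real-valued norm and inner product *)

(** Real-valued, because the order of [R[i]] is only partial and the estimates below are closed by
    real arithmetic. *)
Definition nrm (R : realType) (H : hilbertType R) (x : H) : R := complex.Re `|x|.

Definition rip (R : realType) (H : hilbertType R) (x y : H) : R :=
  complex.Re (inner x y).

Section Real_geometry.
Local Open Scope complex_scope.
Context {R : realType} {H : hilbertType R}.
Implicit Types (x y z : H) (r s : R) (c : R[i]).

Lemma ReD (a b : R[i]) : complex.Re (a + b) = complex.Re a + complex.Re b.
Proof. by case: a; case: b. Qed.

Lemma ReN (a : R[i]) : complex.Re (- a) = - complex.Re a.
Proof. by case: a. Qed.

Lemma Re_sum I (r : seq I) (P : pred I) (F : I -> R[i]) :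
  complex.Re (\sum_(i <- r | P i) F i) = \sum_(i <- r | P i) complex.Re (F i).
Proof. by elim/big_rec2: _ => // i y1 y2 _ <-; rewrite ReD. Qed.

Lemma Re_mulr r c : complex.Re (r%:C * c) = r * complex.Re c.
Proof. by case: c => a b /=; rewrite mul0r subr0. Qed.

Lemma Re_conj c : complex.Re (conjc c) = complex.Re c.
Proof. by case: c. Qed.

Lemma conjE c : Num.conj c = conjc c.
Proof. by []. Qed.

Lemma nrmE x : `|x| = (nrm x)%:C.
Proof. by rewrite /nrm RRe_real// ger0_real. Qed.

Lemma nrm_ge0 x : 0 <= nrm x.
Proof. by have := normr_ge0 x; rewrite nrmE ler0c. Qed.
Hint Resolve nrm_ge0 : core.

Lemma innerxx x : inner x x = (nrm x ^+ 2)%:C.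
Proof. by rewrite innerE nrmE -rmorphXn. Qed.

Lemma ripxx x : rip x x = nrm x ^+ 2.
Proof. by rewrite /rip innerxx. Qed.

Lemma nrm0 : nrm (0 : H) = 0.
Proof. by rewrite /nrm normr0. Qed.

Lemma nrm_eq0 x : (nrm x == 0) = (x == 0).
Proof. by rewrite -(normr_eq0 x) nrmE -(inj_eq (@complexI R)). Qed.

Lemma nrm_gt0 x : (0 < nrm x) = (x != 0).
Proof. by rewrite lt_def nrm_eq0 nrm_ge0 andbT. Qed.

Lemma nrmN x : nrm (- x) = nrm x.
Proof. by rewrite /nrm normrN. Qed.

Lemma nrmC x y : nrm (x - y) = nrm (y - x).
Proof. by rewrite -nrmN opprB. Qed.

Lemma ler_nrmD x y : nrm (x + y) <= nrm x + nrm y.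
Proof. by rewrite -lecR rmorphD/= -!nrmE ler_normD. Qed.

Lemma ler_nrmB x y : nrm (x - y) <= nrm x + nrm y.
Proof. by rewrite -(nrmN y) ler_nrmD. Qed.

Lemma ler_nrm_sum I (r : seq I) (P : pred I) (F : I -> H) :
  nrm (\sum_(i <- r | P i) F i) <= \sum_(i <- r | P i) nrm (F i).
Proof.
elim/big_rec2: _ => [|i y1 y2 _ h]; first by rewrite nrm0.
by apply: le_trans (ler_nrmD _ _) _; rewrite lerD2l.
Qed.

Lemma nrmZ c x : nrm (c *: x) = complex.Re `|c| * nrm x.
Proof. by rewrite /nrm normrZ -[in RHS]Re_mulr RRe_real// ger0_real. Qed.

Lemma nrmZr r x : nrm (r%:C *: x) = `|r| * nrm x.
Proof. by rewrite nrmZ normc_def/= expr0n/= addr0 sqrtr_sqr. Qed.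

Lemma inner_conj x y : inner y x = conjc (inner x y).
Proof. by rewrite -conjE hermC/= expr0 mul1r. Qed.

Lemma inner_eq0C x y : (inner x y = 0) <-> (inner y x = 0).
Proof. by split => h; rewrite inner_conj h rmorph0. Qed.

Lemma innerZl c x y : inner (c *: x) y = c * inner x y.
Proof. by rewrite linearZl_LR. Qed.

Lemma innerZr c x y : inner x (c *: y) = conjc c * inner x y.
Proof. by rewrite linearZr_LR. Qed.

Lemma innerDl x y z : inner (x + y) z = inner x z + inner y z.
Proof. exact: linearDl. Qed.

Lemma innerDr x y z : inner x (y + z) = inner x y + inner x z.
Proof. exact: linearDr. Qed.

Lemma innerNl x z : inner (- x) z = - inner x z.
Proof. exact: linearNl. Qed.

Lemma innerNr x z : inner x (- z) = - inner x z.
Proof. exact: linearNr. Qed.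

Lemma innerBl x y z : inner (x - y) z = inner x z - inner y z.
Proof. exact: linearBl. Qed.

Lemma innerBr x y z : inner x (y - z) = inner x y - inner x z.
Proof. exact: linearBr. Qed.

Lemma inner0l x : inner 0 x = 0.
Proof. exact: linear0l. Qed.

Lemma inner0r x : inner x 0 = 0.
Proof. exact: linear0r. Qed.

Lemma inner_suml I (r : seq I) (P : pred I) (F : I -> H) y :
  inner (\sum_(i <- r | P i) F i) y = \sum_(i <- r | P i) inner (F i) y.
Proof. exact: linear_sumlz. Qed.

Lemma inner_sumr I (r : seq I) (P : pred I) (F : I -> H) x :
  inner x (\sum_(i <- r | P i) F i) = \sum_(i <- r | P i) inner x (F i).
Proof. exact: linear_sumr. Qed.

Lemma ripC x y : rip x y = rip y x.
Proof. by rewrite /rip inner_conj Re_conj. Qed.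

Lemma ripDl x y z : rip (x + y) z = rip x z + rip y z.
Proof. by rewrite /rip linearDl ReD. Qed.

Lemma ripDr x y z : rip x (y + z) = rip x y + rip x z.
Proof. by rewrite /rip linearDr ReD. Qed.

Lemma ripNl x y : rip (- x) y = - rip x y.
Proof. by rewrite /rip linearNl ReN. Qed.

Lemma ripNr x y : rip x (- y) = - rip x y.
Proof. by rewrite /rip linearNr ReN. Qed.

Lemma ripBl x y z : rip (x - y) z = rip x z - rip y z.
Proof. by rewrite ripDl ripNl. Qed.

Lemma ripBr x y z : rip x (y - z) = rip x y - rip x z.
Proof. by rewrite ripDr ripNr. Qed.

Lemma ripZl r x y : rip (r%:C *: x) y = r * rip x y.
Proof. by rewrite /rip innerZl Re_mulr. Qed.

Lemma ripZr r x y : rip x (r%:C *: y) = r * rip x y.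
Proof. by rewrite ripC ripZl ripC. Qed.

Lemma ler_rip x y : `|rip x y| <= nrm x * nrm y.
Proof.
rewrite -lecR rmorphM/= -!nrmE.
exact: le_trans (normc_ge_Re _) (CauchySchwarz_hilbert _ _).
Qed.

Lemma rip_le x y : rip x y <= nrm x * nrm y.
Proof. exact: le_trans (ler_norm _) (ler_rip _ _). Qed.

Lemma nrmD2 x y : nrm (x + y) ^+ 2 = nrm x ^+ 2 + 2 * rip x y + nrm y ^+ 2.
Proof. by rewrite -!ripxx !ripDl !ripDr (ripC y x); ring. Qed.

Lemma nrmB2 x y : nrm (x - y) ^+ 2 = nrm x ^+ 2 - 2 * rip x y + nrm y ^+ 2.
Proof. by rewrite nrmD2 ripNr nrmN mulrN. Qed.

Lemma nrmD2_orth x y : inner x y = 0 -> nrm (x + y) ^+ 2 = nrm x ^+ 2 + nrm y ^+ 2.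
Proof. by move=> h; rewrite nrmD2 /rip h/= mulr0 addr0. Qed.

Lemma unit_vector x : x != 0 -> nrm ((nrm x)^-1%:C *: x) = 1.
Proof.
move=> x0; rewrite nrmZr ger0_norm ?invr_ge0// mulVf//.
by rewrite nrm_eq0.
Qed.

Lemma ltc0_Re (e : R[i]) : 0 < e -> e = (complex.Re e)%:C /\ 0 < complex.Re e.
Proof.
by move=> e0; rewrite RRe_real ?gtr0_real//; split=> //; move: e0; rewrite ltcE => /andP[].
Qed.

Lemma nbhs_nrm x (A : set H) :
  nbhs x A <-> exists2 e : R, 0 < e & forall y, nrm (x - y) < e -> A y.
Proof.
split.
  move=> /nbhs_normP[e e0 h]; have [eE re0] := ltc0_Re e0.
  exists (complex.Re e) => // y hy; apply: h => /=.
  by rewrite eE nrmE ltcR.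
move=> [e e0 h]; apply/nbhs_normP; exists e%:C; first by rewrite /= ltcR.
by move=> y /=; rewrite nrmE ltcR; exact: h.
Qed.

Lemma cvg_nrmP (u : nat -> H) x :
  u @ \oo --> x <-> forall e : R, 0 < e ->
    exists N, forall n, (N <= n)%N -> nrm (u n - x) < e.
Proof.
split.
  move=> ux e e0; have [] := (proj1 (@cvgrPdist_lt _ _ _ _ _ u x) ux e%:C).
    by rewrite ltcR.
  move=> N _ h; exists N => n Nn; have /= := h n Nn.
  by rewrite distrC nrmE ltcR.
move=> h; apply/cvgrPdist_lt => e /ltc0_Re[eE re0].
have [N hN] := h _ re0; exists N => // n /= Nn.
by rewrite distrC nrmE eE ltcR hN.
Qed.

Lemma nrm_complete (u : nat -> H) :
  (forall e : R, 0 < e -> exists N, forall n m, (N <= n)%N -> (N <= m)%N ->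
     nrm (u n - u m) < e) ->
  exists x, u @ \oo --> x.
Proof.
move=> h; suff : cvgn u by move=> /cvg_ex[x hx]; exists x.
apply/cauchy_cvgP/cauchy_exP => e /ltc0_Re[eE re0].
have [N hN] := h _ re0; exists (u N).
exists N => // n /= Nn.
by rewrite -ball_normE/= nrmE eE ltcR hN.
Qed.

Lemma nrm_le_eps x : (forall e : R, 0 < e -> nrm x <= e) -> x = 0.
Proof.
move=> h; apply/eqP; rewrite -nrm_eq0 eq_le nrm_ge0 andbT.
by apply/ler_addgt0Pr => e /h; rewrite add0r.
Qed.

(** Banach's theorem, by iteration from 0. It supplies surjectivity in Lax-Milgram and in the
    openness of the resolvent set. *)
Lemma contraction_fixed_point (f : H -> H) (q : R) : 0 <= q < 1 ->
  (forall x y, nrm (f x - f y) <= q * nrm (x - y)) -> exists x, f x = x.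
Proof.
move=> /andP[q0 q1] fq; pose u n := iter n f 0.
have u1 n : nrm (u n.+1 - u n) <= q ^+ n * nrm (f 0).
  elim: n => [|n ih]; first by rewrite /u/= subr0 expr0 mul1r.
  rewrite exprS -mulrA; apply: le_trans (fq _ _) _.
  by rewrite ler_wpM2l.
pose C := nrm (f 0) / (1 - q).
have p1 : 0 < 1 - q by rewrite subr_gt0.
have C0 : 0 <= C by rewrite divr_ge0// ltW.
(* The factor [1 - q ^+ m] is that of the exact geometric sum, so the induction step closes by an
   identity. *)
have um n m : nrm (u (n + m)%N - u n) <= C * q ^+ n * (1 - q ^+ m).
  elim: m => [|m ih]; first by rewrite addn0 subrr nrm0 expr0 subrr mulr0.
  rewrite addnS -(subrKA (u (n + m)%N)); apply: le_trans (ler_nrmD _ _) _.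
  apply: le_trans (lerD (u1 _) ih) _.
  rewrite exprD exprS /C le_eqVlt; apply/orP; left; apply/eqP.
  by field; rewrite gt_eqF.
have um' n m : (n <= m)%N -> nrm (u m - u n) <= C * q ^+ n.
  move=> nm; rewrite -(subnKC nm); apply: le_trans (um _ _) _.
  apply: ler_piMr; first by apply: mulr_ge0 => //; exact: exprn_ge0.
  by rewrite gerBl exprn_ge0.
have Cq (e : R) : 0 < e -> exists N, C * q ^+ N < e.
  move=> e0; have /cvgrPdist_lt/(_ _ e0)[N _ hN] :
    (fun n => C * q ^+ n) @ \oo --> (0 : R).
    by have := @cvg_geometric R C q; rewrite ger0_norm//; exact.
  exists N; have := hN N (leqnn N); rewrite sub0r normrN ger0_norm//.
  by rewrite mulr_ge0// exprn_ge0.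
have [x ux] : exists x, u @ \oo --> x.
  apply: nrm_complete => e e0; have [N hN] := Cq _ (divr_gt0 e0 (ltr0Sn _ 1)).
  exists N => n m Nn Nm; rewrite -(subrKA (u N)).
  apply: le_lt_trans (ler_nrmD _ _) _; rewrite (nrmC (u N)).
  rewrite (splitr e) ltrD//.
    exact: le_lt_trans (um' _ _ Nn) hN.
  exact: le_lt_trans (um' _ _ Nm) hN.
exists x; apply/eqP; rewrite -subr_eq0; apply/eqP/nrm_le_eps => e e0.
have /cvg_nrmP/(_ _ (divr_gt0 e0 (ltr0Sn _ 1)))[N hN] := ux.
rewrite -(subrKA (u N.+1)); apply: le_trans (ler_nrmD _ _) _.
rewrite (splitr e); apply: lerD.
  apply: le_trans (fq _ _) _; rewrite nrmC.
  apply: le_trans (ltW (hN N (leqnn N))).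
  by rewrite ler_piMl// ltW.
by rewrite ltW// hN.
Qed.

End Real_geometry.
#[global] Hint Resolve nrm_ge0 : core.

(** * Orthonormal families *)

Definition orthonormal_family (R : realType) (H : hilbertType R) (I : eqType) (f : I -> H) :=
  forall i j, inner (f i) (f j) = (i == j)%:R.

Definition orth (R : realType) (H : hilbertType R) (x : H) (s : seq H) :=
  forall y, y \in s -> inner x y = 0.

(** The orthogonal projection onto the span of [f], provided that [f] is orthonormal. As a bounded
    operator it is obtained from [finite_rank_compact]. *)
Definition proj (R : realType) (H : hilbertType R) n (f : 'I_n -> H) (x : H) : H :=
  \sum_(i < n) inner x (f i) *: f i.

Definition cabs (R : realType) (c : R[i]) : R := complex.Re `|c|.

Section Orthonormal_families.
Local Open Scope complex_scope.
Context {R : realType} {H : hilbertType R}.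
Implicit Types (x y z : H) (s : seq H).

Lemma cabsE (c : R[i]) : `|c| = (cabs c)%:C.
Proof. by rewrite /cabs RRe_real// ger0_real. Qed.

Lemma cabs_ge0 (c : R[i]) : 0 <= cabs c.
Proof. by have := normr_ge0 c; rewrite cabsE ler0c. Qed.

Lemma cabs2E (c : R[i]) : c * conjc c = (cabs c ^+ 2)%:C.
Proof. by rewrite -sqr_normc cabsE -rmorphXn. Qed.

Lemma cabs_conj (c : R[i]) : cabs (conjc c) = cabs c.
Proof. by rewrite /cabs normcJ. Qed.

Lemma orthonormal_family_nrm (I : eqType) (f : I -> H) i : orthonormal_family f -> nrm (f i) = 1.
Proof.
move=> of1; have := of1 i i; rewrite eqxx innerxx => /(congr1 (@complex.Re R))/=.
by move/eqP; rewrite sqrp_eq1 ?nrm_ge0// => /eqP.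
Qed.

Lemma orthonormal_family_comp (I J : eqType) (f : I -> H) (g : J -> I) :
  injective g -> orthonormal_family f -> orthonormal_family (f \o g).
Proof. by move=> gi fo i j; rewrite /= fo (inj_eq gi). Qed.

Lemma projB n (f : 'I_n -> H) x y : proj f (x - y) = proj f x - proj f y.
Proof. by rewrite -sumrB; apply: eq_bigr => i _; rewrite innerBl scalerBl. Qed.

Section Finite.
Variables (n : nat) (f : 'I_n -> H).
Hypothesis fo : orthonormal_family f.

Lemma inner_lincomb (c : 'I_n -> R[i]) j : inner (\sum_i c i *: f i) (f j) = c j.
Proof.
rewrite inner_suml (bigD1 j)//= innerZl fo eqxx mulr1 big1 ?addr0// => i ij.
by rewrite innerZl fo (negPf ij) mulr0.
Qed.

Lemma inner_lincomb2 (c d : 'I_n -> R[i]) :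
  inner (\sum_i c i *: f i) (\sum_i d i *: f i) = \sum_i c i * conjc (d i).
Proof.
rewrite inner_sumr; apply: eq_bigr => j _.
by rewrite innerZr inner_lincomb mulrC.
Qed.

Lemma inner_proj x j : inner (proj f x) (f j) = inner x (f j).
Proof. exact: inner_lincomb. Qed.

Lemma inner_projB x j : inner (x - proj f x) (f j) = 0.
Proof. by rewrite innerBl inner_proj subrr. Qed.

Lemma inner_proj_orth x y : (forall j, inner y (f j) = 0) -> inner (proj f x) y = 0.
Proof.
move=> h; rewrite inner_suml big1// => i _.
by rewrite innerZl (proj1 (inner_eq0C _ _) (h i)) mulr0.
Qed.

Lemma proj_self x y : inner (proj f x) y = inner x (proj f y).
Proof.
rewrite inner_suml inner_sumr; apply: eq_bigr => i _.
by rewrite innerZl innerZr -inner_conj mulrC.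
Qed.

Lemma nrm_lincomb (c : 'I_n -> R[i]) :
  nrm (\sum_i c i *: f i) ^+ 2 = \sum_i cabs (c i) ^+ 2.
Proof.
rewrite -ripxx /rip inner_lincomb2 Re_sum; apply: eq_bigr => i _.
by rewrite cabs2E.
Qed.

Lemma nrm_proj x : nrm (proj f x) ^+ 2 = \sum_i cabs (inner x (f i)) ^+ 2.
Proof. exact: nrm_lincomb. Qed.

Lemma proj_pythagoras x : nrm x ^+ 2 = nrm (proj f x) ^+ 2 + nrm (x - proj f x) ^+ 2.
Proof.
rewrite -nrmD2_orth ?subrKC//; apply: inner_proj_orth; exact: inner_projB.
Qed.

Lemma bessel x : \sum_i cabs (inner x (f i)) ^+ 2 <= nrm x ^+ 2.
Proof. by rewrite -nrm_proj (proj_pythagoras x) lerDl sqr_ge0. Qed.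

Lemma proj_lincomb (c : 'I_n -> R[i]) : proj f (\sum_i c i *: f i) = \sum_i c i *: f i.
Proof. by rewrite {1}/proj; under eq_bigr do rewrite inner_lincomb. Qed.

Lemma proj_proj x : proj f (proj f x) = proj f x.
Proof. exact: proj_lincomb. Qed.

End Finite.

(** Exchanging the two sums leaves Bessel's inequality for [g] at each unit vector [f j]. The bound
    does not depend on [k], so that finite-dimensional errors disappear from [U k S / k%:R] in the
    limit. *)
Lemma sum_proj_le n k (f : 'I_n -> H) (g : 'I_k -> H) :
  orthonormal_family f -> orthonormal_family g -> \sum_i nrm (proj f (g i)) ^+ 2 <= n%:R.
Proof.
move=> fo go; under eq_bigr do rewrite nrm_proj//.
rewrite exchange_big/=; apply: (@le_trans _ _ (\sum_(i < n) 1)).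
  apply: ler_sum => j _; rewrite -(expr1n R 2) -(orthonormal_family_nrm j fo).
  apply: le_trans _ (bessel go (f j)); apply: ler_sum => i _.
  by rewrite inner_conj cabs_conj.
by rewrite sumr_const card_ord.
Qed.

Definition fcons n y (f : 'I_n -> H) : 'I_n.+1 -> H :=
  fun i => oapp f y (unlift ord0 i).

Lemma fcons0 n y (f : 'I_n -> H) : fcons y f ord0 = y.
Proof. by rewrite /fcons unlift_none. Qed.

Lemma fconsS n y (f : 'I_n -> H) i : fcons y f (lift ord0 i) = f i.
Proof. by rewrite /fcons liftK. Qed.

Lemma orthonormal_family_fcons n y (f : 'I_n -> H) : nrm y = 1 -> orthonormal_family f ->
  (forall i, inner y (f i) = 0) -> orthonormal_family (fcons y f).
Proof.
move=> y1 fo yf i j.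
case: (unliftP ord0 i) => [i' ->|->]; case: (unliftP ord0 j) => [j' ->|->];
  rewrite ?fcons0 ?fconsS.
- by rewrite fo (inj_eq lift_inj).
- by apply/inner_eq0C; rewrite yf.
- by rewrite yf.
- by rewrite innerxx y1 expr1n eqxx.
Qed.

Lemma proj_fcons n y (f : 'I_n -> H) x :
  proj (fcons y f) x = inner x y *: y + proj f x.
Proof.
by rewrite /proj big_ord_recl fcons0; congr (_ + _); apply: eq_bigr => i _;
  rewrite fconsS.
Qed.

(** The last clause says that each [f i] lies in the span of [s], phrased as membership in every
    linear predicate that holds on [s]. *)
Lemma gram_schmidt s : exists n (f : 'I_n -> H),
  [/\ orthonormal_family f, (forall y, y \in s -> proj f y = y) &
      forall V : H -> Prop, V 0 -> (forall c x y, V x -> V y -> V (c *: x + y)) ->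
        (forall y, y \in s -> V y) -> forall i, V (f i)].
Proof.
elim: s => [|y s [n [f [fo fs fV]]]].
  by exists 0%N, (fun _ => 0); split => [[]|//|? ? ? ? []].
have [yf|yf] := eqVneq (y - proj f y) 0.
  exists n, f; split => // [z|V V0 VD Vs i].
    by rewrite inE => /orP[/eqP ->|/fs//]; apply/eqP; rewrite eq_sym -subr_eq0 yf.
  by apply: (fV V) => // z zs; apply: Vs; rewrite inE zs orbT.
set w := (nrm (y - proj f y))^-1%:C *: (y - proj f y).
have w1 : nrm w = 1 by exact: unit_vector.
have wf i : inner w (f i) = 0 by rewrite innerZl inner_projB// mulr0.
exists n.+1, (fcons w f); split => [|z|V V0 VD Vs].
- exact: orthonormal_family_fcons.
- rewrite inE => /orP[/eqP ->|zs]; rewrite proj_fcons; last first.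
    rewrite fs// (_ : inner z w = 0) ?scale0r ?add0r//.
    by rewrite -(fs z zs) inner_proj_orth.
  have yE : y = (nrm (y - proj f y))%:C *: w + proj f y.
    rewrite scalerA -rmorphM/= mulfV ?nrm_eq0// scale1r subrK//.
  have -> : inner y w = (nrm (y - proj f y))%:C.
    rewrite [in LHS]yE innerDl innerZl innerxx w1 expr1n mulr1.
    by rewrite inner_proj_orth ?addr0.
  by rewrite -yE.
- have Vf : forall i, V (f i).
    by apply: fV => // z zs; apply: Vs; rewrite inE zs orbT.
  have Vp : V (proj f y).
    by rewrite /proj; elim/big_ind: _ => // [x z Vx Vz|i _];
      [rewrite -(scale1r x); exact: VD|rewrite -[_ *: _]addr0; exact: VD].
  have Vw : V w.
    rewrite /w -[_ *: _]addr0; apply: (VD _ _ _ _ V0); rewrite addrC -scaleN1r.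
    by apply: VD => //; apply: Vs; rewrite inE eqxx.
  by move=> i; case: (unliftP ord0 i) => [i' ->|->]; rewrite ?fcons0 ?fconsS.
Qed.

Lemma orth_orthonormal_family s : exists n (f : 'I_n -> H), orthonormal_family f /\
  forall x, (forall i, inner x (f i) = 0) <-> orth x s.
Proof.
have [n [f [fo fs fV]]] := gram_schmidt s; exists n, f; split => // x; split.
  by move=> h y ys; rewrite -(fs y ys); apply/inner_eq0C; rewrite inner_proj_orth.
move=> xs; apply: (fV (fun y => inner x y = 0)); last exact: xs.
  by rewrite inner0r.
by move=> c y z xy xz; rewrite innerDr innerZr xy xz mulr0 addr0.
Qed.

(** If every vector equalled its projection onto the span of [s], an orthonormal basis of that span
    would make [H] finite-dimensional. Otherwise some remainder is nonzero and can be normalized. *)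
Lemma exists_unit_orth s : infinite_dimensional H -> exists x, nrm x = 1 /\ orth x s.
Proof.
move=> infH; have [n [f [fo fs]]] := orth_orthonormal_family s.
have [[x xf]|h] := pselect (exists x, x != proj f x).
  exists ((nrm (x - proj f x))^-1%:C *: (x - proj f x)); split.
    by rewrite unit_vector// subr_eq0.
  by apply/fs => i; rewrite innerZl inner_projB// mulr0.
exfalso; apply: (infH n); exists f; split.
  by move=> c c0 i; rewrite -(inner_lincomb fo c) c0 inner0l.
apply/seteqP; split => // x _; exists (fun i => inner x (f i)).
by apply: contrapT => /eqP xf; apply: h; exists x.
Qed.

(** The recursion carries the whole list of earlier vectors, so [Q] may constrain the next vector in
    terms of all of them. *)
Lemma orthonormal_sequence (Q : nat -> seq H -> H -> Prop) :
  (forall n s, exists x, [/\ nrm x = 1, orth x s & Q n s x]) ->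
  exists e : nat -> H, orthonormal_family e /\ forall n, Q n (mkseq e n) (e n).
Proof.
move=> hQ; have /choice[g gP] : forall p : nat * seq H, exists x,
  [/\ nrm x = 1, orth x p.2 & Q p.1 p.2 x] by move=> [n s]; exact: hQ.
pose l := fix l n := if n is m.+1 then rcons (l m) (g (m, l m)) else [::].
pose e n := g (n, l n).
have lE n : l n = mkseq e n by elim: n => //= n ih; rewrite mkseqS -ih.
exists e; split => [|n]; last by rewrite -lE; have [] := gP (n, l n).
have lt i j : (i < j)%N -> inner (e j) (e i) = 0.
  move=> ij; have [_ + _] := gP (j, l j); apply.
  by rewrite /= lE map_f// mem_iota.
move=> i j; have [ij|ji|->] := ltngtP i j.
- by apply/inner_eq0C; rewrite lt.
- by rewrite lt.
- by rewrite ?eqxx innerxx; have [-> _ _] := gP (j, l j); rewrite expr1n.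
Qed.

Lemma orthonormal_basis_exists : separable_hilbert H -> infinite_dimensional H ->
  exists e : nat -> H, orthonormal_basis e.
Proof.
move=> [D cD dD] infH.
have [d dP] : exists d : nat -> H, forall x, D x -> exists n, d n = x.
  have /countable_injP[g gi] := cD.
  exists (fun n => xget 0 [set x | D x /\ g x = n]) => x Dx; exists (g x).
  have [Dy yx] := @xgetPex _ 0 [set y | D y /\ g y = g x] (ex_intro _ x (conj Dx erefl)).
  by apply: gi; rewrite ?inE.
(* The condition says that [d n] lies in the span of [s] and [x], expressed through orthogonal
   complements. *)
have [|e [eo ed]] := @orthonormal_sequence
    (fun n s x => forall y, orth y s -> inner y x = 0 -> inner y (d n) = 0).
  move=> n s; have [m [f [fo fs]]] := orth_orthonormal_family s.
  have fd y : orth y s -> inner y (proj f (d n)) = 0.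
    by move=> /fs ys; apply/inner_eq0C; rewrite inner_proj_orth.
  (* If [d n] is already in the span of [s], any new unit vector will do; otherwise its normalized
     remainder is adjoined. *)
  have [r0|r0] := eqVneq (d n - proj f (d n)) 0.
    have [x [x1 xs]] := exists_unit_orth s infH.
    by exists x; split => // y /fd ys _; rewrite -(subrK (proj f (d n)) (d n)) r0 add0r.
  exists ((nrm (d n - proj f (d n)))^-1%:C *: (d n - proj f (d n))); split.
  - exact: unit_vector.
  - by apply/fs => i; rewrite innerZl inner_projB// mulr0.
  - move=> y /fd ys /eqP; rewrite innerZr mulf_eq0 conjc_eq0 => /orP[|/eqP yr].
      by rewrite (inj_eq (@complexI R)) invr_eq0 nrm_eq0 (negPf r0).
    by rewrite -(subrK (proj f (d n)) (d n)) innerDr ys yr addr0.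
(* A vector [x] orthogonal to all [e n] is orthogonal to every [d n]. For a [z = d n] within [a] of
   [x], this gives [nrm x ^+ 2 = rip x (x - z) <= nrm x * a]. *)
exists e; split => // x xe; apply: nrm_le_eps => a a0.
have [z [xz /dP[n dn]]] : ball x a%:C `&` D !=set0.
  apply: dD; first by exists x; apply: ballxx; rewrite ltcR.
  by apply: ball_open; rewrite ltcR.
move: xz; rewrite -ball_normE/= nrmE ltcR => xz.
have xz0 : rip x z = 0.
  have xs : orth x (mkseq e n).
    by move=> y /mapP[i _ ->].
  by rewrite /rip -dn (ed n x xs (xe n)).
have : nrm x ^+ 2 <= nrm x * a.
  rewrite -ripxx -[leLHS]subr0 -xz0 -ripBr; apply: le_trans (rip_le _ _) _.
  by rewrite ler_wpM2l ?nrm_ge0// ltW.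
have [-> _|x0] := eqVneq x 0; first by rewrite nrm0 ltW.
by rewrite expr2 ler_pM2l// nrm_gt0.
Qed.

(** By Bessel's inequality the partial sums are Cauchy. Their limit has the same coefficients as
    [x], so totality of [e] identifies it with [x]. *)
Lemma fourier (e : nat -> H) x : orthonormal_basis e ->
  (fun n => \sum_(i < n) inner x (e i) *: e i) @ \oo --> x.
Proof.
move=> [eo eT]; pose f n (i : 'I_n) := e i.
have fo n : orthonormal_family (f n) by apply: orthonormal_family_comp eo; exact: ord_inj.
pose u n := proj (f n) x; pose b n : R := \sum_(0 <= i < n) cabs (inner x (e i)) ^+ 2.
have bE n : b n = \sum_(i < n) cabs (inner x (e i)) ^+ 2 by rewrite /b big_mkord.
have bx n : b n <= nrm x ^+ 2 by rewrite bE; exact: (bessel (fo n)).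
have uE n m : (n <= m)%N -> nrm (u m - u n) ^+ 2 = b m - b n.
  move=> nm; have -> : u m - u n = u m - proj (f n) (u m).
    congr (_ - _); apply: eq_bigr => i _; congr (_ *: _).
    by rewrite -[f n i]/(f m (widen_ord nm i)) inner_proj.
  have := proj_pythagoras (fo n) (u m); rewrite !nrm_proj//.
  rewrite -!/(u _) (eq_bigr (fun i : 'I_n => cabs (inner x (e i)) ^+ 2)); last first.
    by move=> i _; rewrite -[f n i]/(f m (widen_ord nm i)) inner_proj.
  by rewrite -!bE => ->; rewrite [b n + _]addrC addrK.
have bm n m : (n <= m)%N -> b n <= b m.
  by move=> nm; rewrite -subr_ge0 -uE// sqr_ge0.
have cb : cvgn b.
  apply: nondecreasing_is_cvgn => //.
  by exists (nrm x ^+ 2) => _ [n _ <-].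
have [y uy] : exists y, u @ \oo --> y.
  apply: nrm_complete => a a0.
  have /cvgrPdist_lt/(_ (a ^+ 2 / 2))[|N _ hN] := cb; first by rewrite divr_gt0// exprn_gt0.
  exists N => n m Nn Nm; wlog nm : n m Nn Nm / (n <= m)%N => [hw|].
    have /orP[nm|mn] := leq_total n m; first exact: hw.
    by rewrite nrmC; exact: hw.
  rewrite nrmC -(@ltr_pXn2r _ 2) ?nnegrE ?nrm_ge0 ?(ltW a0)// uE//.
  have := hN n Nn; have := hN m Nm; rewrite /= !ltr_norml => /andP[] h1 h2 /andP[] h3 h4.
  lra.
suff xy : x = y by rewrite {2}xy.
apply/eqP; rewrite -subr_eq0; apply/eqP/eT => i.
apply/eqP; rewrite -(normr_eq0 (inner _ _)) cabsE.
apply/eqP; congr (_%:C); apply/eqP; rewrite eq_le cabs_ge0 andbT.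
apply/ler_addgt0Pr => a a0; rewrite add0r.
have /cvg_nrmP/(_ _ a0)[N hN] := uy.
(* This index is past [N] and also large enough for [e i] to belong to the family projected on. *)
have Mi : (i < maxn N i.+1)%N by rewrite leq_max leqnn orbT.
have xu : inner (x - u (maxn N i.+1)) (e i) = 0.
  by rewrite -[e i]/(f _ (Ordinal Mi)) inner_projB.
have -> : inner (x - y) (e i) = inner (u (maxn N i.+1) - y) (e i).
  by rewrite -[RHS]add0r -xu -innerDl subrKA.
rewrite -lecR -cabsE; apply: le_trans (CauchySchwarz_hilbert _ _) _.
by rewrite !nrmE (orthonormal_family_nrm i eo) mulr1 lecR ltW// hN// leq_maxl.
Qed.

End Orthonormal_families.

(** * Bounded operators *)

Section Bounded_operators.
Local Open Scope complex_scope.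
Context {R : realType} {H : hilbertType R}.
Implicit Types (x y z : H) (r : R) (A B K S T : bounded_op H).

(** Operators are produced as existence statements with a pointwise equation, which avoids
    equalities between [bounded_op] records. *)
Lemma bop_exists (f : H -> H) (M : R) :
  (forall c x y, f (c *: x + y) = c *: f x + f y) ->
  (forall x, nrm (f x) <= M * nrm x) -> exists T : bounded_op H, forall x, T x = f x.
Proof.
move=> fl fM; pose l := GRing.isLinear.Build _ _ _ _ f fl.
pose F : {linear H -> H} := HB.pack f l.
have Fc : continuous F.
  apply: bounded_linear_continuous; apply/linear_boundedP.
  exists M%:C; split; first by rewrite complex_real.
  move=> r Mr x; rewrite !nrmE.
  apply: (@le_trans _ _ (M%:C * (nrm x)%:C)).
    by rewrite -rmorphM/= lecR; exact: fM.
  by rewrite ler_wpM2r ?ler0c ?nrm_ge0// ltW.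
by exists (BoundedOp Fc).
Qed.

Lemma bopD A x y : A (x + y) = A x + A y.
Proof. exact: linearD. Qed.

Lemma bopB A x y : A (x - y) = A x - A y.
Proof. exact: linearB. Qed.

Lemma bopN A x : A (- x) = - A x.
Proof. exact: linearN. Qed.

Lemma bopZ A c x : A (c *: x) = c *: A x.
Proof. exact: linearZ. Qed.

Lemma bop_0 A : A 0 = 0.
Proof. exact: linear0. Qed.

Lemma bop_sum A I (s : seq I) (P : pred I) (F : I -> H) :
  A (\sum_(i <- s | P i) F i) = \sum_(i <- s | P i) A (F i).
Proof. exact: linear_sum. Qed.

Lemma bop_bound A : exists2 M : R, 0 < M & forall x, nrm (A x) <= M * nrm x.
Proof.
have /linear_boundedP[y [yr h]] : bounded_near A (nbhs (0 : H)).
  by apply: continuous_linear_bounded; exact: bop_continuous.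
have [M yM] : exists2 M : R, 0 < M & y < M%:C.
  exists (`|complex.Re y| + 1); first by rewrite ltr_wpDl.
  rewrite -(RRe_real yr) ltcR; apply: le_lt_trans (ler_norm _) _.
  by rewrite ltrDl.
by move=> yM'; exists M => // x; have := h _ yM' x; rewrite !nrmE -rmorphM lecR.
Qed.

Lemma rip_bop_bound A : exists2 M : R, 0 < M &
  forall x y, `|rip (A x) y| <= M * nrm x * nrm y.
Proof.
have [M M0 hM] := bop_bound A; exists M => // x y; apply: le_trans (ler_rip _ _) _.
by rewrite ler_wpM2r ?nrm_ge0.
Qed.

Lemma op_norm_le (f : H -> H) (M : R) :
  (forall x, nrm x <= 1 -> nrm (f x) <= M) -> f 0 = 0 -> op_norm f <= M.
Proof.
move=> fM f0; apply: ge_sup.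
  by exists (nrm (f 0)), 0; rewrite //= normr0.
by move=> _ [x /= + <-]; rewrite nrmE lecR => /fM.
Qed.

Lemma op_norm_ub (f : H -> H) (M : R) x :
  (forall x, nrm x <= 1 -> nrm (f x) <= M) -> nrm x <= 1 -> nrm (f x) <= op_norm f.
Proof.
move=> fM x1; apply: ub_le_sup; last by exists x => //=; rewrite nrmE lecR.
by exists M => _ [y /= + <-]; rewrite nrmE lecR => /fM.
Qed.

Lemma nrm_le_op_norm A x : nrm (A x) <= op_norm A * nrm x.
Proof.
have [->|x0] := eqVneq x 0; first by rewrite bop_0 nrm0 mulr0.
have [M M0 hM] := bop_bound A.
have : nrm (A ((nrm x)^-1%:C *: x)) <= op_norm A.
  apply: (@op_norm_ub _ M); last by rewrite unit_vector.
  by move=> z z1; apply: le_trans (hM z) _; rewrite ler_piMr// ltW.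
rewrite bopZ nrmZr ger0_norm ?invr_ge0 ?nrm_ge0// mulrC ler_pdivrMr//.
by rewrite nrm_gt0.
Qed.

Lemma op_norm_ge0 A : 0 <= op_norm A.
Proof.
have [M M0 hM] := bop_bound A.
rewrite -(@nrm0 _ H) -(bop_0 A); apply: (@op_norm_ub _ M); last by rewrite nrm0.
by move=> z z1; apply: le_trans (hM z) _; rewrite ler_piMr// ltW.
Qed.

Lemma bop_lincomb A B (c d : R[i]) : exists T : bounded_op H, forall x, T x = c *: A x + d *: B x.
Proof.
have [M M0 hM] := bop_bound A; have [N N0 hN] := bop_bound B.
apply: (@bop_exists _ (cabs c * M + cabs d * N)) => [a x y|x].
  rewrite !bopD !bopZ !(scalerDr c) !(scalerDr d) addrACA; congr (_ + _).
  by rewrite scalerDr !scalerA (mulrC a) (mulrC a d).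
apply: le_trans (ler_nrmD _ _) _; rewrite !nrmZ mulrDl -!mulrA.
by apply: lerD; rewrite ler_wpM2l ?cabs_ge0.
Qed.

Lemma bop_opp A : exists B : bounded_op H, forall x, B x = - A x.
Proof.
by have [B BE] := bop_lincomb A A (-1) 0; exists B => x;
  rewrite BE scale0r addr0 scaleN1r.
Qed.

Lemma bop_comp A B : exists T : bounded_op H, forall x, T x = A (B x).
Proof.
have [M M0 hM] := bop_bound A; have [N N0 hN] := bop_bound B.
apply: (@bop_exists _ (M * N)) => [a x y|x]; first by rewrite !bopD !bopZ.
apply: le_trans (hM _) _; rewrite -mulrA ler_wpM2l//; exact: ltW.
Qed.

Lemma bop_id : exists T : bounded_op H, forall x, T x = x.
Proof. by apply: (@bop_exists id 1) => [//|x]; rewrite mul1r. Qed.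

(** The lower bound gives injectivity of [A] and the bound [c^-1] for the inverse. *)
Lemma bijective_bop_inverse A (c : R) : 0 < c ->
  (forall x, c * nrm x <= nrm (A x)) -> (forall y, exists x, A x = y) ->
  exists T : bounded_op H, (forall x, T (A x) = x) /\ (forall x, A (T x) = x).
Proof.
move=> c0 cA /choice[g gA].
have Ai x y : A x = A y -> x = y.
  move=> xy; apply/eqP; rewrite -subr_eq0 -nrm_eq0 eq_le nrm_ge0 andbT.
  by have := cA (x - y); rewrite bopB xy subrr nrm0 pmulr_rle0.
have [||T TE] := @bop_exists g c^-1.
- by move=> a x y; apply: Ai; rewrite bopD bopZ !gA.
- by move=> x; rewrite mulrC ler_pdivlMr// mulrC -{2}(gA x); exact: cA.
by exists T; split=> x; rewrite TE//; apply: Ai; rewrite gA.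
Qed.

(* [x |-> x - r (A x - y)] is a contraction for small [r > 0]. *)
Lemma lax_milgram A (c : R) : 0 < c -> (forall x, c * nrm x ^+ 2 <= rip (A x) x) ->
  exists T : bounded_op H, (forall x, T (A x) = x) /\ (forall x, A (T x) = x).
Proof.
move=> c0 cA; have cA' x : c * nrm x <= nrm (A x).
  have [->|x0] := eqVneq x 0; first by rewrite bop_0 nrm0 mulr0.
  rewrite -(@ler_pM2r _ (nrm x)) ?nrm_gt0// -mulrA -expr2.
  exact: le_trans (cA x) (rip_le _ _).
apply: bijective_bop_inverse cA' _ => // y.
have [M0 M00 hM0] := bop_bound A.
(* The choice [r = c / M ^+ 2] minimizes [1 - 2 r c + r^2 M^2], which bounds the squared contraction
   factor; [M >= c] keeps the minimum [q2] nonnegative. *)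
pose M := Num.max M0 c.
have M_gt0 : 0 < M by rewrite lt_max M00.
have hM x : nrm (A x) <= M * nrm x.
  by apply: le_trans (hM0 x) _; rewrite ler_wpM2r ?nrm_ge0// le_max lexx.
have cM : c <= M by rewrite le_max lexx orbT.
pose r := c / M ^+ 2; pose q2 := 1 - c ^+ 2 / M ^+ 2.
have q21 : q2 < 1 by rewrite gtrBl divr_gt0// exprn_gt0.
have q20 : 0 <= q2.
  rewrite subr_ge0 ler_pdivrMr ?exprn_gt0// mul1r ler_sqr ?nnegrE// ltW//.
have r0 : 0 < r by rewrite divr_gt0// exprn_gt0.
have [||x] := @contraction_fixed_point _ _ (fun x => x - r%:C *: (A x - y)) (Num.sqrt q2).
- by rewrite sqrtr_ge0/= -[ltRHS]sqrtr1 ltr_sqrt.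
- move=> x z; have -> : x - r%:C *: (A x - y) - (z - r%:C *: (A z - y))
      = (x - z) - r%:C *: A (x - z).
    rewrite opprB [_ - z]addrC addrACA; congr (_ + _).
    by rewrite addrC -scalerBr bopB -[RHS]scalerN opprB addrA subrK opprB.
  move: (x - z) => {}x {z}.
  rewrite -(@ler_pXn2r _ 2) ?nnegrE ?mulr_ge0 ?sqrtr_ge0 ?nrm_ge0//.
  rewrite exprMn sqr_sqrtr// nrmB2 ripZr ripC nrmZr (gtr0_norm r0) exprMn.
  have h1 := cA x.
  have h2 : nrm (A x) ^+ 2 <= M ^+ 2 * nrm x ^+ 2.
    by rewrite -exprMn ler_sqr ?nnegrE ?nrm_ge0// mulr_ge0 ?nrm_ge0// ltW.
  have h3 : r * (c * nrm x ^+ 2) <= r * rip (A x) x by rewrite ler_pM2l.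
  have h4 : r ^+ 2 * nrm (A x) ^+ 2 <= r ^+ 2 * (M ^+ 2 * nrm x ^+ 2).
    by rewrite ler_wpM2l ?sqr_ge0.
  have e1 : r ^+ 2 * (M ^+ 2 * nrm x ^+ 2) = r * (c * nrm x ^+ 2).
    by rewrite /r; field; rewrite gt_eqF.
  have e2 : q2 * nrm x ^+ 2 = nrm x ^+ 2 - r * (c * nrm x ^+ 2).
    by rewrite /r /q2; field; rewrite gt_eqF.
  rewrite e2; rewrite e1 in h4; lra.
- move=> /eqP; rewrite -subr_eq0 addrAC subrr add0r oppr_eq0 scaler_eq0.
  rewrite (inj_eq (@complexI R)) (gt_eqF r0)/= subr_eq0 => /eqP Ax.
  by exists x.
Qed.

Lemma selfadjoint_lincomb A B T r s : selfadjoint A -> selfadjoint B ->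
  (forall x, T x = r%:C *: A x + s%:C *: B x) -> selfadjoint T.
Proof.
move=> sA sB TE x y; rewrite !TE innerDl innerDr !innerZl !innerZr sA sB.
by rewrite !conjc_real.
Qed.

Lemma rip_selfadjoint A x y : selfadjoint A -> rip (A x) y = rip x (A y).
Proof. by move=> sA; rewrite /rip sA. Qed.

Lemma selfadjoint_form_real A x : selfadjoint A -> inner (A x) x = (rip (A x) x)%:C.
Proof.
move=> sA; rewrite /rip RRe_real//; apply/Creal_ImP.
have : inner (A x) x = conjc (inner (A x) x) by rewrite -inner_conj sA.
rewrite -complexIm; case: (inner _ _) => a b [] /eqP.
by rewrite -addr_eq0 -mulr2n mulrn_eq0/= => /eqP ->.
Qed.

(* Polarization, at [y = (|x| / |A x|) A x]. *)
Lemma nrm_selfadjoint_le A (m : R) x : selfadjoint A ->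
  (forall x, `|rip (A x) x| <= m * nrm x ^+ 2) -> nrm (A x) <= m * nrm x.
Proof.
move=> sA hm.
have pol y : 4 * rip (A x) y <= 2 * m * (nrm x ^+ 2 + nrm y ^+ 2).
  have := hm (x + y); have := hm (x - y).
  rewrite nrmB2 nrmD2 !bopB !bopD !ripBl !ripBr !ripDl !ripDr !ler_norml.
  rewrite (rip_selfadjoint y x sA) (ripC y (A x)).
  by move=> /andP[h1 h2] /andP[h3 h4]; lra.
have [A0|A0] := eqVneq (A x) 0.
  rewrite A0 nrm0; have [->|x0] := eqVneq x 0; first by rewrite nrm0 mulr0.
  have := hm x; rewrite A0 /rip inner0l/= normr0 pmulr_lge0 ?exprn_gt0 ?nrm_gt0//.
  by move=> m0; rewrite mulr_ge0 ?nrm_ge0.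
have x0 : x != 0 by apply: contra_neq A0 => ->; rewrite bop_0.
have := pol ((nrm x / nrm (A x))%:C *: A x).
have a0 : 0 < nrm (A x) by rewrite nrm_gt0.
have b0 : 0 < nrm x by rewrite nrm_gt0.
rewrite ripZr ripxx nrmZr ger0_norm ?divr_ge0 ?nrm_ge0//.
have -> : nrm x / nrm (A x) * nrm (A x) ^+ 2 = nrm x * nrm (A x).
  by field; rewrite gt_eqF.
rewrite divfK ?gt_eqF// => h; rewrite -(ler_pM2l b0); lra.
Qed.

End Bounded_operators.

(** * Compactness *)

Section Compactness.
Local Open Scope complex_scope.
Context {R : realType} {H : hilbertType R}.
Implicit Types (x y z : H) (A B K S T : bounded_op H).

Lemma precompact_add (A B C : set H) : precompact A -> precompact B ->
  (forall z, C z -> exists x y, [/\ A x, B y & z = x + y]) -> precompact C.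
Proof.
move=> [U AU [cU _]] [V BV [cV _]] h.
have cUV : compact ((fun p : H * H => p.1 + p.2) @` (U `*` V)).
  apply: continuous_compact; last exact: compact_setX.
  by apply: continuous_subspaceT => p; exact: add_continuous.
exists ((fun p : H * H => p.1 + p.2) @` (U `*` V)).
  by move=> z /h[x [y [Ax By ->]]]; exists (x, y); split; [exact: AU|exact: BV].
by split=> //; apply: compact_closed => //; exact: norm_hausdorff.
Qed.

Lemma precompact_segment (C : R) (v : H) :
  precompact [set r%:C *: v | r in `[- C, C]].
Proof.
have c : compact [set r%:C *: v | r in `[- C, C]].
  apply: continuous_compact; last exact: segment_compact.
  apply: continuous_subspaceT => r; apply/cvgrPdist_lt => e /ltc0_Re[eE e0].
  have v1 : 0 < nrm v + 1 by rewrite ltr_wpDl ?nrm_ge0.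
  near=> s; rewrite eE -scalerBl -rmorphB/= nrmE ltcR nrmZr.
  have : `|r - s| < complex.Re e / (nrm v + 1).
    near: s; apply: (proj1 (@cvgrPdist_lt _ _ _ (nbhs r) _ id r) _); first exact: cvg_id.
    exact: divr_gt0.
  rewrite ltr_pdivlMr// => h; apply: le_lt_trans _ h.
  by rewrite ler_wpM2l// lerDl.
by exists [set r%:C *: v | r in `[- C, C]] => //; split=> //;
  apply: compact_closed => //; exact: norm_hausdorff.
Unshelve. all: by end_near. Qed.

(** The real and imaginary parts of the coefficient place the disc inside the sum of two segments,
    along [v] and along ['i *: v]. *)
Lemma precompact_disc (C : R) (v : H) :
  precompact [set c *: v | c in [set c : R[i] | cabs c <= C]].
Proof.
apply: (precompact_add (precompact_segment C v) (precompact_segment C ('i *: v))).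
move=> _ [c /= cC <-]; exists ((complex.Re c)%:C *: v), ((complex.Im c)%:C *: ('i *: v)).
have /andP[h1 h2] : (`|complex.Re c| <= C) && (`|complex.Im c| <= C).
  move: cC; case: c => a b /=; rewrite /cabs normc_def/= => cC.
  by apply/andP; split; apply: le_trans cC; rewrite -sqrtr_sqr ler_sqrt
    ?lerDl ?lerDr ?addr_ge0 ?sqr_ge0.
split.
- by exists (complex.Re c) => //=; rewrite in_itv/= -ler_norml.
- by exists (complex.Im c) => //=; rewrite in_itv/= -ler_norml.
- by rewrite scalerA [(complex.Im c)%:C * _]mulrC -scalerDl -complexE.
Qed.

(** The image of the unit ball lies in a sum of [n] discs, added one at a time. The operator [B] in
    the coefficients also covers products such as a projection after [B]. *)
Lemma finite_rank_compact n B (u v : 'I_n -> H) : exists K : bounded_op H,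
  compact_op K /\ forall x, K x = \sum_i inner (B x) (u i) *: v i.
Proof.
have [M M0 hM] := bop_bound B.
have cuE x y : cabs (inner (B x) y) <= M * nrm y * nrm x.
  rewrite -lecR -cabsE; apply: le_trans (CauchySchwarz_hilbert _ _) _.
  by rewrite !nrmE -rmorphM/= lecR mulrAC ler_wpM2r ?nrm_ge0.
have [||K KE] := @bop_exists _ _ (fun x => \sum_i inner (B x) (u i) *: v i)
    (\sum_i M * nrm (u i) * nrm (v i)).
- move=> c x y; rewrite scaler_sumr -big_split/=; apply: eq_bigr => i _.
  by rewrite bopD bopZ innerDl innerZl scalerDl scalerA.
- move=> x; apply: le_trans (ler_nrm_sum _ _ _) _; rewrite mulr_suml.
  apply: ler_sum => i _; by rewrite nrmZ (mulrAC _ (nrm (v i))) ler_wpM2r ?nrm_ge0// cuE.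
exists K; split=> //; rewrite /compact_op.
suff h m (mn : (m <= n)%N) : precompact
    [set \sum_(i < m) inner (B x) (u (widen_ord mn i)) *: v (widen_ord mn i)
      | x in [set x | nrm x <= 1]].
  apply: precompact_subset (h n (leqnn n)) => _ [x /= x1 <-].
  exists x; first by move: x1; rewrite nrmE lecR.
  by rewrite KE; apply: eq_bigr => i _; congr (inner _ (u _) *: v _); exact: val_inj.
elim: m mn => [|m ih] mn.
  apply: precompact_subset (precompact_disc 0 0) => _ [x _ <-].
  rewrite big_ord0; exists 0; last by rewrite scaler0.
  by rewrite /= /cabs normr0.
have := precompact_disc (M * nrm (u (Ordinal mn))) (v (Ordinal mn)).
move=> /(precompact_add (ih (ltnW mn))); apply => _ [x /= x1 <-].
rewrite big_ord_recr/=; set s := \sum_i _.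
exists s, (inner (B x) (u (Ordinal mn)) *: v (Ordinal mn)); split.
- exists x => //; apply: eq_bigr => i _.
  by congr (inner _ (u _) *: v _); exact: val_inj.
- exists (inner (B x) (u (Ordinal mn))) => //=.
  apply: le_trans (cuE _ _) _.
  by rewrite ler_piMr// mulr_ge0 ?nrm_ge0// ltW.
- by congr (_ + inner _ (u _) *: v _); exact: val_inj.
Qed.

(** Infinitely many of the images [K (e n)] come close to a cluster point, so two with distinct
    indices are close to each other; no subsequence has to be extracted. *)
Lemma compact_close_pair K (e : nat -> H) (d : R) : compact_op K -> 0 < d ->
  (forall n, nrm (e n) <= 1) ->
  exists n m, n != m /\ nrm (K (e n) - K (e m)) < d.
Proof.
move=> [U KU [cU _]] d0 e1.
have [|p [_ pc]] := cU ((K \o e) @ \oo) _.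
  by exists 0%N => // n _; apply: KU; exists (e n) => //=; rewrite nrmE lecR.
have near_p N : exists2 n, (N <= n)%N & nrm (p - K (e n)) < d / 2.
  have [|| _ [[n Nn <-] h]] := pc [set K (e n) | n in [set n | (N <= n)%N]]
      [set y | nrm (p - y) < d / 2].
  - by exists N => // n /= Nn; exists n.
  - by apply/nbhs_nrm; exists (d / 2); rewrite ?divr_gt0.
  - by exists n.
have [n _ hn] := near_p 0%N; have [m nm hm] := near_p n.+1.
exists n, m; split; first by rewrite neq_ltn nm.
rewrite -(subrKA p) (splitr d); apply: le_lt_trans (ler_nrmD _ _) _.
by rewrite ltrD// nrmC.
Qed.

End Compactness.

(** * The trace formula *)

Section Trace_formula.
Local Open Scope complex_scope.
Context {R : realType} {H : hilbertType R}.
Hypotheses (sepH : separable_hilbert H) (infH : infinite_dimensional H).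
Implicit Types (x y z : H) (A B K S T P : bounded_op H) (k : nat).

(** In any basis [e], the partial sums of the trace are those of [inner (A (f j)) (f j)] with the
    second [f j] replaced by its truncated Fourier expansion. *)
Lemma trace_finite_rank k A (f : 'I_k -> H) (P : H -> H) : orthonormal_family f ->
  (forall x, P x = proj f x) -> trace (A \o P) = \sum_i inner (A (f i)) (f i).
Proof.
move=> fo PE; rewrite /trace; set Q := (X in xget 0 X).
have Qf : Q (\sum_i inner (A (f i)) (f i)).
  move=> e eb; rewrite (_ : (fun n => _) = (fun n => \sum_(j < k)
      inner (A (f j)) (\sum_(i < n) inner (f j) (e i) *: e i))); last first.
    apply/funext => n; under [RHS]eq_bigr do rewrite inner_sumr.
    rewrite exchange_big/=; apply: eq_bigr => i _.
    rewrite PE bop_sum inner_suml; apply: eq_bigr => j _.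
    by rewrite bopZ innerZl innerZr -inner_conj.
  pose F j n : R[i]^o := inner (A (f j)) (\sum_(i < n) inner (f j) (e i) *: e i).
  apply: (@cvg_big R[i]^o 'I_k +%R 0 xpredT (@add_continuous R[i]^o) nat \oo
    (index_enum _) F (fun j => inner (A (f j)) (f j))) => j _.
  apply/cvgrPdist_lt => a /ltc0_Re[aE a0]; rewrite aE {aE}.
  have n1 : 0 < nrm (A (f j)) + 1 by rewrite ltr_wpDl ?nrm_ge0.
  have /cvg_nrmP/(_ _ (divr_gt0 a0 n1))[N hN] := @fourier _ _ _ (f j) eb.
  exists N => // n /= /hN; rewrite nrmC ltr_pdivlMr// => h.
  rewrite -innerBr; apply: le_lt_trans (CauchySchwarz_hilbert _ _) _.
  rewrite !nrmE -rmorphM ltcR; apply: le_lt_trans h.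
  by rewrite mulrC ler_wpM2l ?nrm_ge0// lerDl.
(* The set defining [trace] quantifies over bases, so its element is unique only because a basis
   indexed by [nat] exists. *)
have [e eb] := orthonormal_basis_exists sepH infH.
apply: xget_unique => // z Qz.
exact: (cvg_unique (@norm_hausdorff _ R[i]^o) (Qz e eb) (Qf e eb)).
Qed.

Lemma projectionsP k P : projections k P <->
  exists2 f : 'I_k -> H, orthonormal_family f & forall x, P x = proj f x.
Proof.
split; last first.
  move=> [f fo PE]; split; first split.
  - by move=> x; rewrite !PE proj_proj.
  - by move=> x y; rewrite !PE proj_self.
  - exists f; split=> [c c0 i|].
      by rewrite -(inner_lincomb fo c) c0 inner0l.
    apply/seteqP; split => x.
      by move=> [y _ <-]; exists (fun i => inner y (f i)); rewrite PE.
    by move=> [c ->]; exists (\sum_i c i *: f i) => //; rewrite PE proj_lincomb.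
move=> [[PP sP] [v [vfree vrange]]].
have [n [f [fo fv fP]]] := gram_schmidt (codom v).
have rv x : range P x -> exists c : 'I_k -> R[i], x = \sum_(i < k) c i *: v i.
  by rewrite vrange.
have Pv i : P (v i) = v i.
  have [y _ <-] : range P (v i).
    rewrite vrange; exists (fun j => (i == j)%:R).
    rewrite (bigD1 i)//= eqxx scale1r big1 ?addr0// => j ji.
    by rewrite eq_sym (negPf ji) scale0r.
  exact: PP.
have Pf i : P (f i) = f i.
  apply: (fP (fun x => P x = x)); first exact: bop_0.
    by move=> c x y Px Py; rewrite bopD bopZ Px Py.
  by move=> _ /codomP[j ->].
have fvj j : proj f (v j) = v j by apply: fv; exact: codom_f.
have PE x : P x = proj f x.
  have [c cE] := rv (P x) (ex_intro2 _ _ x I erefl).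
  rewrite -[RHS](_ : proj f (P x) = _); last first.
    by rewrite /proj; apply: eq_bigr => i _; rewrite sP Pf.
  rewrite cE /proj; under [RHS]eq_bigr do rewrite inner_suml scaler_suml.
  rewrite [RHS]exchange_big/=; apply: eq_bigr => j _.
  by rewrite -{1}(fvj j) scaler_sumr; apply: eq_bigr => i _; rewrite innerZl scalerA.
have /choice[b bE] j : exists c : 'I_k -> R[i], f j = \sum_(i < k) c i *: v i.
  by apply: rv; exists (f j).
(* [C] and [B] are the two change-of-basis matrices between [v] and [f] on the range of [P]. Both
   products are identities, which forces [n = k]. *)
pose C := \matrix_(i < k, j < n) inner (v i) (f j).
pose B := \matrix_(j < n, i < k) b j i.
have BA : B *m C = 1%:M.
  apply/matrixP => i j; rewrite !mxE -fo {1}bE inner_suml; apply: eq_bigr => l _.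
  by rewrite !mxE innerZl.
have AB : C *m B = 1%:M.
  apply/matrixP => i j; apply/eqP; rewrite -subr_eq0; apply/eqP.
  apply: (vfree (fun j => (C *m B) i j - (1%:M : 'M[R[i]]_k) i j)) => {j}.
  under eq_bigr do rewrite scalerBl; rewrite sumrB.
  rewrite (_ : \sum_(l < k) (1%:M : 'M[R[i]]_k) i l *: v l = v i); last first.
    rewrite (bigD1 i)//= mxE eqxx scale1r big1 ?addr0// => j ji.
    by rewrite mxE eq_sym (negPf ji) scale0r.
  apply/eqP; rewrite subr_eq0; apply/eqP.
  rewrite -[RHS](fvj i) /proj; under [RHS]eq_bigr do rewrite [X in _ *: X]bE scaler_sumr.
  rewrite [RHS]exchange_big/=; apply: eq_bigr => l _; rewrite mxE scaler_suml.
  by apply: eq_bigr => j _; rewrite !mxE scalerA.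
have nk : n = k by apply/eqP; rewrite eqn_leq (mulmx1_min BA) (mulmx1_min AB).
by subst n; exists f.
Qed.

Definition form_sums k A : set R :=
  [set \sum_i rip (A (f i)) (f i) | f in [set f : 'I_k -> H | orthonormal_family f]].

Lemma trace_set k A :
  [set complex.Re (trace (A \o P)) | P in projections k] = form_sums k A.
Proof.
apply/seteqP; split => z.
  move=> [P /projectionsP[f fo PE] <-]; exists f => //.
  by rewrite (trace_finite_rank _ fo)// Re_sum.
move=> [f /= fo <-].
have [I IE] := @bop_id _ H.
have [P [_ PE]] := finite_rank_compact I f f.
have PE' x : P x = proj f x by rewrite PE IE.
exists P; first by apply/projectionsP; exists f.
by rewrite (trace_finite_rank _ fo)// Re_sum.
Qed.

Lemma UE k A : U k A = sup (form_sums k A).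
Proof. by rewrite /U trace_set. Qed.

(** Through this identity every statement about [L] is reduced to one about [U]. *)
Lemma LE k A B : (forall x, B x = - A x) -> L k A = - U k B.
Proof.
move=> BE; rewrite UE /L trace_set /inf; congr (- sup _).
apply/seteqP; split => [_ [_ [f fo <-] <-]|_ [f fo <-]].
  by exists f => //; rewrite -sumrN; apply: eq_bigr => i _; rewrite BE ripNl.
exists (\sum_i rip (A (f i)) (f i)); first by exists f.
by rewrite -sumrN; apply: eq_bigr => i _; rewrite BE ripNl.
Qed.

Lemma exists_orthonormal_family k : exists f : 'I_k -> H, orthonormal_family f.
Proof.
have [|e [eo _]] := @orthonormal_sequence _ H (fun _ _ _ => True).
  by move=> _ s; have [x [x1 xs]] := exists_unit_orth s infH; exists x.
by exists (e \o val); apply: orthonormal_family_comp eo; exact: val_inj.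
Qed.

Lemma U_le k A (M : R) : (forall f : 'I_k -> H, orthonormal_family f ->
  \sum_i rip (A (f i)) (f i) <= M) -> U k A <= M.
Proof.
move=> h; rewrite UE; apply: ge_sup; last by move=> _ [f fo <-]; exact: h.
by have [f fo] := exists_orthonormal_family k; exists (\sum_i rip (A (f i)) (f i)), f.
Qed.

Lemma U_ge k A (f : 'I_k -> H) : orthonormal_family f -> \sum_i rip (A (f i)) (f i) <= U k A.
Proof.
move=> fo; rewrite UE; apply: ub_le_sup; last by exists f.
exists (\sum_(i < k) op_norm A) => _ [g go <-]; apply: ler_sum => i _.
apply: le_trans (rip_le _ _) _; rewrite (orthonormal_family_nrm i go) mulr1.
by apply: le_trans (nrm_le_op_norm _ _) _; rewrite (orthonormal_family_nrm i go) mulr1.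
Qed.

End Trace_formula.

(** * The top of the essential spectrum *)

(* By Courant-Fischer, [a] is the maximum of the essential spectrum of [S]. *)
Definition ess_top (R : realType) (H : hilbertType R) (S : bounded_op H) (a : R) :=
  (forall e : R, 0 < e -> exists s : seq H, forall x, orth x s ->
     rip (S x) x <= (a + e) * nrm x ^+ 2) /\
  (forall (e : R) (s : seq H), 0 < e -> exists x, [/\ nrm x = 1, orth x s &
     a - e < rip (S x) x]).

Section Essential_top.
Local Open Scope complex_scope.
Context {R : realType} {H : hilbertType R}.
Hypothesis (infH : infinite_dimensional H).
Implicit Types (x y z : H) (s : seq H) (A B K S T P : bounded_op H) (a e : R).

Lemma orth_cat x s1 s2 : orth x (s1 ++ s2) -> orth x s1 /\ orth x s2.
Proof.
by move=> h; split => y ys; apply: h; rewrite mem_cat ys ?orbT.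
Qed.

Lemma orthD c x y s : orth x s -> orth y s -> orth (c *: x + y) s.
Proof.
by move=> xs ys z zs; rewrite innerDl innerZl xs// ys// mulr0 addr0.
Qed.

Lemma rip_unit_le S x : nrm x = 1 -> `|rip (S x) x| <= op_norm S.
Proof.
move=> x1; apply: le_trans (ler_rip _ _) _; rewrite x1 mulr1.
by rewrite -[leRHS]mulr1 -x1 nrm_le_op_norm.
Qed.

(** The value is the supremum of the levels [r] that the form exceeds on unit vectors orthogonal to
    any finite set. A level above it must fail for some finite set, which is the first clause of
    [ess_top]. *)
Lemma ess_top_exists S : exists a, ess_top S a.
Proof.
pose E : set R := [set r | forall s, exists x, [/\ nrm x = 1, orth x s & r < rip (S x) x]].
have E0 : E !=set0.
  exists (- op_norm S - 1) => s; have [x [x1 xs]] := exists_unit_orth s infH.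
  exists x; split => //; have := rip_unit_le S x1; rewrite ler_norml => /andP[h _].
  by apply: lt_le_trans h; rewrite gtrBl.
have Eub : has_ubound E.
  exists (op_norm S) => r /(_ [::])[x [x1 _ rx]]; apply: le_trans (ltW rx) _.
  exact: le_trans (ler_norm _) (rip_unit_le S x1).
exists (sup E); split=> [e e0|e s e0].
  have : ~ E (sup E + e).
    by move=> /(ub_le_sup Eub); rewrite gerDl leNgt e0.
  move=> /existsNP[s hs]; exists s => x xs.
  have [->|x0] := eqVneq x 0; first by rewrite nrm0 expr0n/= mulr0 /rip inner0r.
  rewrite leNgt; apply/negP => h; apply: hs.
  exists ((nrm x)^-1%:C *: x); split; first exact: unit_vector.
    by move=> y ys; rewrite innerZl xs// mulr0.
  rewrite bopZ ripZl ripZr mulrA -expr2 exprVn mulrC ltr_pdivlMr//.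
  by rewrite exprn_gt0// nrm_gt0.
have [r Er rS] := sup_adherent e0 (conj E0 Eub).
by have [x [x1 xs rx]] := Er s; exists x; split => //; exact: lt_trans rx.
Qed.

Lemma rip_split S x y : selfadjoint S ->
  rip (S (x + y)) (x + y) = rip (S x) x + 2 * rip (S x) y + rip (S y) y.
Proof.
move=> sS; rewrite bopD ripDl !ripDr (rip_selfadjoint y x sS) (ripC y); ring.
Qed.

(* Cauchy-Schwarz for the form of [a + d - S], which is nonnegative on a
   finite-codimensional subspace, bounds [(a + d - S) x] by its value at [x]. *)
Lemma weyl_vector S a e s : selfadjoint S -> ess_top S a -> 0 < e ->
  exists x, [/\ nrm x = 1, orth x s & nrm (S x - a%:C *: x) < e].
Proof.
move=> sS [top1 top2] e0; have [M M0 hM] := rip_bop_bound S.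
pose N := `|a| + 1 + M; have N0 : 0 < N by rewrite ltr_wpDl// addr_ge0.
(* The bound 1 ensures [|a + d| + M <= N]; the other two make [d <= e / 4] and the residual [t] at
   most [e / 2]. *)
pose d := Num.min 1 (Num.min (e / 4) (e ^+ 2 / (8 * N))).
have d0 : 0 < d by rewrite !lt_min ltr01 !divr_gt0// ?mulr_gt0// exprn_gt0.
have d1 : d <= 1 by rewrite !ge_min lexx.
have d2 : d <= e / 4 by rewrite !ge_min lexx/= orbT.
have d3 : 2 * d * N <= (e / 2) ^+ 2.
  have : d <= e ^+ 2 / (8 * N) by rewrite !ge_min lexx/= !orbT.
  by rewrite ler_pdivlMr ?mulr_gt0// => h; rewrite expr_div_n; nra.
have [G hG] := top1 d d0.
(* Orthogonality to [map S G] puts [t = c x - S x] in the complement of [G] as well, so the form of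
   [c - S] is nonnegative on the span of [x] and [t]. *)
have [x [x1 xs xd]] := top2 d (s ++ G ++ map S G) d0.
move: xs => /orth_cat[xs /orth_cat[xG xSG]]; exists x; split => //.
pose c := a + d; pose t := c%:C *: x - S x.
have tG : orth t G.
  move=> y yG; rewrite innerBl innerZl xG// mulr0 sub0r sS xSG ?oppr0//.
  exact: map_f.
have form y : orth y G -> 0 <= c * nrm y ^+ 2 - rip (S y) y.
  by move=> yG; rewrite subr_ge0; exact: hG.
have cN : `|c| + M <= N.
  rewrite lerD2r; apply: le_trans (ler_normD _ _) _.
  by rewrite lerD2l gtr0_norm.
have tt : nrm t ^+ 2 <= 2 * d * N.
  (* Let [q] be the form of [c - S]. At [x - t / N] it equals [q x - 2 |t|^2 / N + q t / N^2]; with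
     [q x <= 2 d] and [q t <= N |t|^2], nonnegativity gives the bound. *)
  have := form ((- N^-1)%:C *: t + x) (orthD _ tG xG).
  rewrite nrmD2 (rip_split _ _ sS) bopZ !ripZl !ripZr nrmZr normrN gtr0_norm ?invr_gt0//.
  have tE : c * rip t x - rip (S t) x = nrm t ^+ 2.
    by rewrite -[RHS]ripxx {4}/t ripBr ripZr (rip_selfadjoint t x sS).
  have h1 : c * nrm t ^+ 2 - rip (S t) t <= N * nrm t ^+ 2.
    have := hM t t; rewrite ler_norml -mulrA -expr2 => /andP[h _].
    have : c * nrm t ^+ 2 <= `|c| * nrm t ^+ 2 by rewrite ler_wpM2r ?sqr_ge0// ler_norm.
    have : (`|c| + M) * nrm t ^+ 2 <= N * nrm t ^+ 2 by rewrite ler_wpM2r ?sqr_ge0.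
    lra.
  have h2 : c * nrm x ^+ 2 - rip (S x) x <= 2 * d.
    by rewrite x1 expr1n mulr1 /c; lra.
  have h3 : N^-1 ^+ 2 * (c * nrm t ^+ 2 - rip (S t) t) <= N^-1 * nrm t ^+ 2.
    apply: (@le_trans _ _ (N^-1 ^+ 2 * (N * nrm t ^+ 2))).
      by rewrite ler_wpM2l ?sqr_ge0.
    by rewrite le_eqVlt; apply/orP; left; apply/eqP; field; rewrite gt_eqF.
  move=> h4; suff : N^-1 * nrm t ^+ 2 <= 2 * d by rewrite ler_pdivrMl// mulrC.
  have -> : N^-1 * nrm t ^+ 2 = 2 * (N^-1 * (c * rip t x - rip (S t) x)) - N^-1 * nrm t ^+ 2.
    by rewrite tE; ring.
  lra.
have t2 : nrm t <= e / 2.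
  rewrite -(@ler_pXn2r _ 2) ?nnegrE ?nrm_ge0//; first exact: le_trans tt d3.
  by rewrite divr_ge0// ltW.
have -> : S x - a%:C *: x = d%:C *: x - t.
  rewrite /t opprB addrCA; congr (_ + _); rewrite -scalerBl -scaleNr -rmorphN -rmorphB.
  by congr (_%:C *: _); rewrite /c; ring.
apply: le_lt_trans (ler_nrmB _ _) _; rewrite nrmZr x1 gtr0_norm// mulr1.
lra.
Qed.

Lemma weyl_sequence S a e s : selfadjoint S -> ess_top S a -> 0 < e ->
  exists u : nat -> H, [/\ orthonormal_family u, forall n, orth (u n) s &
    forall n, nrm (S (u n) - a%:C *: u n) < e].
Proof.
move=> sS tS e0; have [|u [uo uQ]] := @orthonormal_sequence _ H
    (fun _ _ x => orth x s /\ nrm (S x - a%:C *: x) < e).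
  move=> _ l; have [x [x1 /orth_cat[xl xs] xe]] := weyl_vector (l ++ s) sS tS e0.
  by exists x.
by exists u; split => // n; have [] := uQ n.
Qed.

(** In an orthonormal Weyl sequence, take two members with close images under [K]: their difference
    has squared norm 2 and is still an approximate eigenvector. *)
Lemma weyl_compact S K a e : selfadjoint S -> ess_top S a -> compact_op K -> 0 < e ->
  exists x, [/\ 1 <= nrm x, nrm (S x - a%:C *: x) < e & nrm (K x) < e].
Proof.
move=> sS tS cK e0.
have [u [uo _ ue]] := weyl_sequence [::] sS tS (divr_gt0 e0 (ltr0Sn R 1)).
have [n|n [m [nm hK]]] := compact_close_pair (e := u) cK e0.
  by rewrite (orthonormal_family_nrm n uo).
exists (u n - u m); split; last by rewrite bopB.
  rewrite -(@ler_pXn2r _ 2) ?nnegrE ?nrm_ge0// expr1n nrmB2 /rip uo (negPf nm)/=.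
  by rewrite (orthonormal_family_nrm n uo) (orthonormal_family_nrm m uo) !expr1n; lra.
have -> : S (u n - u m) - a%:C *: (u n - u m) =
    (S (u n) - a%:C *: u n) - (S (u m) - a%:C *: u m).
  rewrite bopB scalerBr !opprB [a%:C *: u m - a%:C *: u n]addrC addrACA.
  by congr (_ + _); rewrite addrC.
apply: le_lt_trans (ler_nrmB _ _) _; rewrite (splitr e); apply: ltrD; exact: ue.
Qed.

(** An inverse [T] modulo compacts would give [|x| <= |T (S x - a x)| + |K x|]. At a Weyl vector
    with tolerance [(M + 1)^-1] the right side is below 1, against [1 <= |x|]. *)
Lemma essential_spectrum_top S a : selfadjoint S -> ess_top S a ->
  essential_spectrum S a%:C.
Proof.
move=> sS tS [T [[K cK KE] _]]; have [M M0 hM] := bop_bound T.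
have M1 : 0 < (M + 1)^-1 by rewrite invr_gt0 ltr_wpDl// ltW.
have [x [x1 xS xK]] := weyl_compact sS tS cK M1.
have : nrm x <= nrm (T (S x - a%:C *: x)) + nrm (K x).
  by rewrite -KE -{1}(subKr (T (S x - a%:C *: x)) x) ler_nrmB.
have h1 := hM (S x - a%:C *: x).
have h2 : M * nrm (S x - a%:C *: x) < M * (M + 1)^-1 by rewrite ltr_pM2l.
have h3 : M * (M + 1)^-1 + (M + 1)^-1 = 1.
  by field; rewrite gt_eqF// ltr_wpDl// ltW.
lra.
Qed.

Lemma compact_op0 : exists2 K : bounded_op H, compact_op K & forall x, K x = 0.
Proof.
have [I IE] := @bop_id _ H.
have [K [cK KE]] := finite_rank_compact I (fun _ : 'I_0 => 0) (fun _ => 0).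
by exists K => // x; rewrite KE big_ord0.
Qed.

(** Multiplied by ['i * Im l], the operator [S - l] has a form with real part [(Im l)^2 |x|^2]. For
    [Im l] nonzero it is thus coercive, and [S - l] is invertible. *)
Lemma essential_spectrum_real S (l : R[i]) : selfadjoint S ->
  essential_spectrum S l -> complex.Im l = 0.
Proof.
move=> sS; apply: contra_notP => /eqP b0.
have [I IE] := @bop_id _ H; pose c := 'i * (complex.Im l)%:C.
have [A AE] := bop_lincomb S I c (- (c * l)).
have AE' x : A x = c *: (S x - l *: x) by rewrite AE IE scaleNr scalerBr scalerA.
have [||T [TA AT]] := @lax_milgram _ _ A (complex.Im l ^+ 2).
- by rewrite exprn_even_gt0.
- move=> x; rewrite AE' /rip innerZl innerBl innerZl selfadjoint_form_real// innerxx.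
  rewrite /c; case: l {c AE AE' b0} => r b /=.
  by rewrite !(mul0r, mulr0, add0r, addr0, subr0, mulr1, mul1r, oppr0, sub0r); lra.
have [T' T'E] := bop_lincomb T I c 0.
have T'E' x : T' x = c *: T x by rewrite T'E scale0r addr0.
have [K cK KE] := compact_op0.
exists T'; split; exists K => // x; rewrite KE T'E'.
  by rewrite -bopZ -AE' TA subrr.
by rewrite bopZ (scalerA l) (mulrC l) -(scalerA c) -scalerBr -AE' AT subrr.
Qed.

(* [r - S + c Q] is coercive for a finite-rank projection [Q] and [c] large. *)
Lemma essential_spectrum_le S a r : selfadjoint S -> ess_top S a ->
  essential_spectrum S r%:C -> r <= a.
Proof.
move=> sS [top1 _]; apply: contra_notT; rewrite -ltNge => ar.
pose e := (r - a) / 2; have e0 : 0 < e by rewrite divr_gt0// subr_gt0.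
have [s hs] := top1 e e0; have [n [f [fo fs]]] := orth_orthonormal_family s.
have [I IE] := @bop_id _ H.
have [B BE] := bop_lincomb I S r%:C (-1)%:C.
have BE' x : B x = r%:C *: x - S x by rewrite BE IE rmorphN scaleNr scale1r.
have sB : selfadjoint B.
  by apply: selfadjoint_lincomb BE => // x y; rewrite !IE.
have [M M0 hM] := rip_bop_bound B.
(* On the component [u], the three terms pay for the lower bound [- M] of the form, for the cross
   term split by Young's inequality, and for the coercivity constant. *)
pose c := M + 2 * M ^+ 2 / e + e / 2.
have [Q [_ QE0]] := finite_rank_compact I f f.
have QE x : Q x = proj f x by rewrite QE0 IE.
have [A AE] := bop_lincomb B Q 1%:C c%:C.
have AE' x : A x = r%:C *: x - S x + c%:C *: proj f x by rewrite AE BE' QE scale1r.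
have [||T [TA AT]] := @lax_milgram _ _ A (e / 2).
- by rewrite divr_gt0.
- move=> x; rewrite AE scale1r QE ripDl ripZl (proj_pythagoras fo x).
  set u := proj f x; set v := x - u; have xE : x = u + v by rewrite /v subrKC.
  have vs : orth v s by apply/fs => i; rewrite inner_projB.
  have -> : rip u x = nrm u ^+ 2.
    by rewrite xE ripDr ripxx /rip inner_proj_orth ?addr0// => j; rewrite inner_projB.
  rewrite {1 2}xE (rip_split _ _ sB).
  have h1 : e * nrm v ^+ 2 <= rip (B v) v.
    have := hs v vs; rewrite BE' ripBl ripZl ripxx => h.
    have -> : e * nrm v ^+ 2 = r * nrm v ^+ 2 - (a + e) * nrm v ^+ 2.
      by rewrite /e; field.
    lra.
  have h2 : - (M * nrm u ^+ 2) <= rip (B u) u.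
    by have := hM u u; rewrite ler_norml -mulrA -expr2 => /andP[].
  have h3 : - (M * nrm u * nrm v) <= rip (B u) v.
    by have := hM u v; rewrite ler_norml => /andP[].
  have h4 : 2 * (M * nrm u * nrm v) <= 2 * M ^+ 2 / e * nrm u ^+ 2 + e / 2 * nrm v ^+ 2.
    have -> : 2 * M ^+ 2 / e * nrm u ^+ 2 + e / 2 * nrm v ^+ 2 =
        2 * (M * nrm u * nrm v) + e / 2 * (2 * M / e * nrm u - nrm v) ^+ 2.
      by field; rewrite gt_eqF.
    by rewrite lerDl mulr_ge0 ?sqr_ge0// divr_ge0// ltW.
  rewrite /c; lra.
(* [T] inverts [r - S + c Q], so [- T] inverts [S - r] up to [- c T Q] on one side and [- c Q T] on
   the other, both of finite rank. *)
have [T' T'E'] := bop_opp T.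
exists T'; split.
  have [K [cK KE]] := finite_rank_compact I f (fun i => - (c%:C *: T (f i))).
  exists K => // x; rewrite KE IE T'E' -bopN opprB.
  have -> : r%:C *: x - S x = A x - c%:C *: proj f x by rewrite AE' addrK.
  rewrite bopB TA addrAC subrr add0r bopZ bop_sum scaler_sumr -sumrN.
  apply: eq_bigr => i _.
  by rewrite bopZ scalerN !scalerA mulrC.
have [K [cK KE]] := finite_rank_compact T f (fun i => - (c%:C *: f i)).
exists K => // x; rewrite KE T'E' bopN scalerN opprK (addrC (- S (T x))).
have := AT x; rewrite AE' => h.
rewrite (_ : r%:C *: T x - S (T x) = x - c%:C *: proj f (T x)); last first.
  by apply/eqP; rewrite eq_sym subr_eq h.
rewrite addrAC subrr add0r scaler_sumr -sumrN; apply: eq_bigr => i _.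
by rewrite scalerN !scalerA mulrC.
Qed.

Lemma essential_spectrum_opp S T (l : R[i]) : (forall x, T x = - S x) ->
  essential_spectrum S l -> essential_spectrum T (- l).
Proof.
move=> TE; apply: contra_not => -[V [[K1 c1 E1] [K2 c2 E2]]].
have [V' V'E] := bop_opp V.
exists V'; split; [exists K1|exists K2] => // x.
  by rewrite -E1 TE V'E -bopN scaleNr opprD !opprK.
by rewrite -E2 TE V'E bopN scalerN scaleNr opprK.
Qed.

(** [is_max] ranges over complex numbers in a partial order, so the bound on real points must be
    joined with the reality of the essential spectrum. *)
Lemma alpha_plusE S a : selfadjoint S -> ess_top S a -> alpha_plus S = a.
Proof.
move=> sS tS; apply: xget_unique.
  split; first exact: essential_spectrum_top.
  move=> z Sz; have := essential_spectrum_real sS Sz.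
  case: z Sz => x y Sz /= y0; rewrite y0 in Sz *.
  by rewrite lecR; exact: essential_spectrum_le Sz.
move=> b [Sb hb]; apply/eqP; rewrite eq_le (essential_spectrum_le sS tS Sb)/=.
by rewrite -lecR; apply: hb; exact: essential_spectrum_top.
Qed.

Lemma alpha_minusE S T a : selfadjoint S -> (forall x, T x = - S x) ->
  ess_top T a -> alpha_minus S = - a.
Proof.
move=> sS TE tT; have sT : selfadjoint T by move=> x y; rewrite !TE innerNl innerNr sS.
have ST x : S x = - T x by rewrite TE opprK.
have Sa : essential_spectrum S (- a)%:C.
  by rewrite rmorphN; apply: (essential_spectrum_opp ST); exact: essential_spectrum_top.
have Sle r : essential_spectrum S r%:C -> - a <= r.
  move=> /(essential_spectrum_opp TE); rewrite -rmorphN lerNl.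
  exact: essential_spectrum_le.
apply: xget_unique.
  split => // z Sz; have := essential_spectrum_real sS Sz.
  case: z Sz => x y Sz /= y0; rewrite y0 in Sz *.
  by rewrite lecR; exact: Sle.
move=> b [Sb hb]; apply/eqP; rewrite eq_le (Sle _ Sb) andbT.
by rewrite -lecR; exact: hb.
Qed.

End Essential_top.

(** * Limits and the essential norm *)

Section Limits.
Local Open Scope complex_scope.
Context {R : realType} {H : hilbertType R}.
Hypotheses (sepH : separable_hilbert H) (infH : infinite_dimensional H).
Implicit Types (x y z : H) (s : seq H) (A B K S T P : bounded_op H) (a b e : R).

(** With [- b] in the role of the minimum of the essential spectrum, this compares minimum and
    maximum, by testing both forms on one unit vector. *)
Lemma ess_top_opp_ge S T a b : (forall x, T x = - S x) ->
  ess_top S a -> ess_top T b -> 0 <= a + b.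
Proof.
move=> TE [h1 _] [h2 _]; apply/ler_addgt0Pr => e e0.
have [s1 hs1] := h1 _ (divr_gt0 e0 (ltr0Sn R 1)).
have [s2 hs2] := h2 _ (divr_gt0 e0 (ltr0Sn R 1)).
have [x [x1 /orth_cat[xs1 xs2]]] := exists_unit_orth (s1 ++ s2) infH.
have := hs1 x xs1; have := hs2 x xs2; rewrite x1 TE ripNl expr1n; lra.
Qed.

Lemma U_ge_top S a k : ess_top S a -> k%:R * a <= U k S.
Proof.
move=> [_ top2]; apply/ler_addgt0Pr => e e0.
have k0 : 0 < k%:R + 1 :> R by rewrite ltr_wpDl.
have [|u [uo uQ]] := @orthonormal_sequence _ H
    (fun _ _ x => a - e / (k%:R + 1) < rip (S x) x).
  by move=> _ s; apply: top2; rewrite divr_gt0.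
have uo' : orthonormal_family (u \o val : 'I_k -> H).
  by apply: orthonormal_family_comp uo; exact: val_inj.
rewrite -lerBlDr; apply: le_trans (U_ge sepH infH S uo').
apply: (@le_trans _ _ (\sum_(i < k) (a - e / (k%:R + 1)))); last first.
  by apply: ler_sum => i _; exact: (ltW (uQ i)).
rewrite sumr_const card_ord -[leRHS]mulr_natl mulrBr lerD2l lerN2 mulrCA.
by rewrite ler_piMr ?(ltW e0)// ler_pdivrMr// mul1r lerDl.
Qed.

(** Each term exceeds [a + e] by at most [C] times the squared norm of its component in a fixed
    [n]-dimensional space, and [sum_proj_le] bounds the sum of those by [n] for every [k]. *)
Lemma U_le_top S a e : selfadjoint S -> ess_top S a -> 0 < e ->
  exists C, forall k, U k S <= k%:R * (a + e) + C.
Proof.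
move=> sS [top1 _] e0; pose d := e / 2.
have d0 : 0 < d by rewrite divr_gt0.
have [s hs] := top1 d d0; have [n [f [fo fs]]] := orth_orthonormal_family s.
have [M M0 hM] := rip_bop_bound S.
(* [M] bounds the form on [u], [M ^+ 2 / d] comes from splitting the cross term, and [|a|] from
   writing [|v|^2 = 1 - |u|^2]. *)
pose C := M + M ^+ 2 / d + `|a| + d; have C0 : 0 <= C.
  have := normr_ge0 a; have : 0 <= M ^+ 2 / d by rewrite divr_ge0 ?sqr_ge0// ltW.
  by rewrite /C; lra.
exists (C * n%:R) => k; apply: (U_le sepH infH) => g go.
apply: (@le_trans _ _ (\sum_(i < k) (a + e + C * nrm (proj f (g i)) ^+ 2))).
  apply: ler_sum => i _; set u := proj f (g i); set v := g i - u.
  have xE : g i = u + v by rewrite /v subrKC.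
  have vs : orth v s by apply/fs => j; rewrite inner_projB.
  have uv : nrm u ^+ 2 + nrm v ^+ 2 = 1.
    by rewrite -(proj_pythagoras fo) (orthonormal_family_nrm i go) expr1n.
  rewrite xE (rip_split _ _ sS).
  have h1 := hs v vs.
  have h2 : rip (S u) u <= M * nrm u ^+ 2.
    by have := hM u u; rewrite ler_norml -mulrA -expr2 => /andP[].
  have h3 : rip (S u) v <= M * nrm u * nrm v.
    by have := hM u v; rewrite ler_norml => /andP[].
  have h4 : 2 * (M * nrm u * nrm v) <= M ^+ 2 / d * nrm u ^+ 2 + d * nrm v ^+ 2.
    have -> : M ^+ 2 / d * nrm u ^+ 2 + d * nrm v ^+ 2 =
        2 * (M * nrm u * nrm v) + d * (M / d * nrm u - nrm v) ^+ 2.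
      by field; rewrite gt_eqF.
    by rewrite lerDl mulr_ge0 ?sqr_ge0// ltW.
  have h5 : - a * nrm u ^+ 2 <= `|a| * nrm u ^+ 2.
    by rewrite ler_wpM2r ?sqr_ge0// -normrN ler_norm.
  have h6 : (a + d) * nrm v ^+ 2 + d * nrm v ^+ 2 =
      a + e - a * nrm u ^+ 2 - e * nrm u ^+ 2.
    have -> : nrm v ^+ 2 = 1 - nrm u ^+ 2 by lra.
    by rewrite /d; field.
  have h7 : 0 <= e * nrm u ^+ 2 by rewrite mulr_ge0 ?sqr_ge0// ltW.
  have h8 : 0 <= d * nrm u ^+ 2 by rewrite mulr_ge0 ?sqr_ge0// ltW.
  rewrite /C; lra.
rewrite big_split/= sumr_const card_ord -[(a + e) *+ k]mulr_natl lerD2l -mulr_sumr.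
by rewrite ler_wpM2l// sum_proj_le.
Qed.

Lemma U_cvg S a : selfadjoint S -> ess_top S a ->
  (fun k : nat => U k S / k%:R) @ \oo --> a.
Proof.
move=> sS tS; apply/cvgrPdist_le => e e0.
have e2 : 0 < e / 2 by rewrite divr_gt0.
have [C hC] := U_le_top sS tS e2.
near=> k.
have k0 : (0 : R) < k%:R by rewrite ltr0n; near: k; exists 1%N.
have h1 : a <= U k S / k%:R by rewrite ler_pdivlMr// mulrC U_ge_top.
have h2 : U k S / k%:R <= a + e.
  rewrite ler_pdivrMr//; apply: le_trans (hC k) _.
  have : C <= k%:R * (e / 2).
    rewrite -ler_pdivrMr//; near: k; exact: nbhs_infty_ger.
  lra.
rewrite ler_norml; apply/andP; split; lra.
Unshelve. all: by end_near. Qed.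

Lemma compact_opD K1 K2 K : compact_op K1 -> compact_op K2 ->
  (forall x, K x = K1 x + K2 x) -> compact_op K.
Proof.
move=> c1 c2 KE; apply: (precompact_add c1 c2) => _ [x x1 <-].
by exists (K1 x), (K2 x); split; [exists x|exists x|exact: KE].
Qed.

(** With [Q] the projection [proj f], the compact perturbation is [K = Q S Q - Q S - S Q], so that
    [S + K] is the compression [(1 - Q) S (1 - Q)], whose form is bounded on both sides. *)
Lemma essential_norm_le S T a b e : selfadjoint S -> (forall x, T x = - S x) ->
  ess_top S a -> ess_top T b -> 0 < e ->
  exists2 K, compact_op K & op_norm (S \+ K) <= Num.max a b + e.
Proof.
move=> sS TE tS tT e0; set m := Num.max a b.
(* Nonnegativity allows [nrm v] to be replaced by the larger [nrm y] in the final bound. *)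
have m0 : 0 <= m.
  have := ess_top_opp_ge TE tS tT; have : a <= m by rewrite le_max lexx.
  have : b <= m by rewrite le_max lexx orbT.
  lra.
have [s1 hs1] := tS.1 e e0; have [s2 hs2] := tT.1 e e0.
have [n [f [fo fs]]] := orth_orthonormal_family (s1 ++ s2).
have [I IE] := @bop_id _ H.
have [K1 [c1 K1E]] := finite_rank_compact I (fun i => proj f (S (f i)) - S (f i)) f.
have [K2 [c2 K2E]] := finite_rank_compact I f (fun i => - S (f i)).
have [K KE0] := bop_lincomb K1 K2 1 1.
have KE x : K x = K1 x + K2 x by rewrite KE0 !scale1r.
have cK : compact_op K by exact: compact_opD KE.
exists K => //.
have [A AE0] := bop_lincomb S K 1 1.
have AE x : A x = S x + K x by rewrite AE0 !scale1r.
have K1E' x : K1 x = proj f (S (proj f x)) - proj f (S x).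
  rewrite K1E IE /proj -sumrB; apply: eq_bigr => i _.
  rewrite -scalerBl; congr (_ *: _).
  by rewrite innerBr -!sS -proj_self -sS.
have K2E' x : K2 x = - S (proj f x).
  rewrite K2E IE /proj bop_sum -sumrN; apply: eq_bigr => i _.
  by rewrite bopZ scalerN.
have AE' x : A x = S (x - proj f x) - proj f (S (x - proj f x)).
  rewrite AE KE K1E' K2E' bopB projB opprB -[RHS]addrA; congr (_ + _).
  by rewrite [RHS]addrC.
have sA : selfadjoint A.
  move=> x y; rewrite !AE' innerBl innerBr proj_self -(proj_self f x).
  by rewrite -innerBl -innerBr sS.
apply: op_norm_le; last by rewrite /= -AE bop_0.
move=> x x1; rewrite /= -AE.
apply: le_trans (@nrm_selfadjoint_le _ _ A (m + e) x sA _) _; last first.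
  by rewrite ler_piMr// addr_ge0// ltW.
move=> y; set v := y - proj f y.
have vs : orth v (s1 ++ s2) by apply/fs => j; rewrite inner_projB.
have [vs1 vs2] := orth_cat vs.
have -> : rip (A y) y = rip (S v) v.
  rewrite AE' -/v ripBl /v ripBr; congr (_ - _).
  by rewrite /rip proj_self.
have vy : nrm v ^+ 2 <= nrm y ^+ 2 by rewrite (proj_pythagoras fo y) lerDr sqr_ge0.
have me : 0 <= m + e by rewrite addr_ge0// ltW.
apply: (@le_trans _ _ ((m + e) * nrm v ^+ 2)); last by rewrite ler_wpM2l.
have h1 : rip (S v) v <= (m + e) * nrm v ^+ 2.
  apply: le_trans (hs1 v vs1) _; rewrite ler_wpM2r ?sqr_ge0// lerD2r.
  by rewrite le_max lexx.
have h2 : - rip (S v) v <= (m + e) * nrm v ^+ 2.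
  rewrite -ripNl -TE; apply: le_trans (hs2 v vs2) _.
  by rewrite ler_wpM2r ?sqr_ge0// lerD2r le_max lexx orbT.
rewrite ler_norml h1 andbT; lra.
Qed.

(** Evaluate [S + K] at an approximate eigenvector that [K] nearly kills. *)
Lemma le_op_norm_compact S K a : selfadjoint S -> ess_top S a -> compact_op K ->
  `|a| <= op_norm (S \+ K).
Proof.
move=> sS tS cK; apply/ler_addgt0Pr => e e0.
have [x [x1 xS xK]] := weyl_compact sS tS cK (divr_gt0 e0 (ltr0Sn R 1)).
have [A AE0] := bop_lincomb S K 1 1.
have AE : (A : H -> H) = S \+ K by apply/funext => y; rewrite /= AE0 !scale1r.
have x0 : 0 < nrm x by exact: lt_le_trans x1.
rewrite -AE -(ler_pM2r x0) -nrmZr mulrDl.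
have -> : a%:C *: x = A x - (S x - a%:C *: x) - K x.
  by rewrite AE/= opprB [S x + K x]addrC -(addrA (K x)) subrKC addrAC subrr add0r.
apply: le_trans (ler_nrmB _ _) _; rewrite -[e in leRHS]mulr1.
have : e * 1 <= e * nrm x by rewrite ler_pM2l.
have := ler_nrmB (A x) (S x - a%:C *: x); have := nrm_le_op_norm A x.
by rewrite mulr1; lra.
Qed.

(** The value is the largest modulus in the essential spectrum. The lower bound by [b] is the one by
    [a] for [- S], as [S + K] and [- S - K] have the same norm. *)
Lemma essential_normE S T a b : selfadjoint S -> (forall x, T x = - S x) ->
  ess_top S a -> ess_top T b -> essential_norm S = Num.max a b.
Proof.
move=> sS TE tS tT; apply/eqP; rewrite eq_le; apply/andP; split.
  apply/ler_addgt0Pr => e e0.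
  have [K cK hK] := essential_norm_le sS TE tS tT e0.
  apply: le_trans hK; apply: ge_inf; last by exists K.
  exists 0 => _ [L cL <-]; apply: le_trans (le_op_norm_compact sS tS cL).
  exact: normr_ge0.
have [K0 c0 _] := @compact_op0 R H.
apply: lb_le_inf; first by exists (op_norm (S \+ K0)), K0.
move=> _ [K cK <-]; have sT : selfadjoint T by move=> x y; rewrite !TE innerNl innerNr sS.
rewrite ge_max (le_trans (ler_norm a) (le_op_norm_compact sS tS cK))/=.
have [K1 [c1 K1E]] : exists K1 : bounded_op H, compact_op K1 /\ forall x, K1 x = - K x.
  have [K' K'E] := bop_opp K.
  exists K'; split => //; apply: precompact_subset cK => _ [x /= x1 <-].
  by exists (- x); rewrite /= ?normrN// K'E bopN.
have -> : op_norm (S \+ K) = op_norm (T \+ K1).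
  rewrite /op_norm; congr (sup _); congr image.
  by apply/funext => x /=; rewrite TE K1E -opprD normrN.
exact: le_trans (ler_norm b) (le_op_norm_compact sT tT c1).
Qed.

End Limits.

(** * Adding the upper part *)

Section Upper_part.
Local Open Scope complex_scope.
Context {R : realType} {H : hilbertType R}.
Hypotheses (sepH : separable_hilbert H) (infH : infinite_dimensional H).
Implicit Types (x y z : H) (S T P : bounded_op H) (a e : R).

Section Dilation.
Variables (S T P : bounded_op H) (a : R) (k : nat).
Hypotheses (sS : selfadjoint S) (tS : ess_top S a) (oP : orthogonal_projection P).
Hypothesis TE : forall x, rip (T x) x = rip (S (P x)) (P x) - a * nrm (P x) ^+ 2.

(* The components [f i - P (f i)] are moved isometrically onto nearly optimal
   Weyl vectors orthogonal to every [P (f i)] and [S (P (f i))]. *)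
Lemma dilation (f : 'I_k -> H) e : orthonormal_family f -> 0 < e -> exists h : 'I_k -> H,
  orthonormal_family h /\ forall i, rip (T (f i)) (f i) + a - e <= rip (S (h i)) (h i).
Proof.
have [PP sP] := oP.
move=> fo e0; pose g i := P (f i).
have [w [fE wg]] : exists w : 'I_k -> H,
    (forall i, f i = w i + g i) /\ (forall i j, inner (w i) (g j) = 0).
  exists (fun i => f i - g i); split=> [i|i j]; first by rewrite subrK.
  by rewrite /g -sP bopB PP subrr inner0l.
have [n [t [to tw _]]] := gram_schmidt (codom w).
have {}tw i : proj t (w i) = w i by apply: tw; exact: codom_f.
have n0 : 0 < n%:R + 1 :> R by rewrite ltr_wpDl.
(* The tolerance is divided by [n + 1] because the errors of [n] vectors, with coefficients of
   modulus at most 1, will be added. *)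
have [v0 [v0o v0s v0d]] :=
  weyl_sequence (codom g ++ map S (codom g)) sS tS (divr_gt0 e0 n0).
pose v (j : 'I_n) := v0 j.
have vo : orthonormal_family v by apply: orthonormal_family_comp v0o; exact: ord_inj.
have vg j i : inner (v j) (g i) = 0.
  by have [h _] := orth_cat (v0s j); apply: h; exact: codom_f.
have vSg j i : inner (v j) (S (g i)) = 0.
  by have [_ h] := orth_cat (v0s j); apply: h; apply: map_f; exact: codom_f.
(* The image of [w i] under the isometry that sends [t j] to [v j]; it preserves the Gram matrix of
   the [w i]. *)
pose y i := \sum_j inner (w i) (t j) *: v j.
have y_orth i z : (forall j, inner (v j) z = 0) -> inner (y i) z = 0.
  move=> vz; rewrite inner_suml big1// => j _.
  by rewrite innerZl vz mulr0.
have yy i l : inner (y i) (y l) = inner (w i) (w l).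
  by rewrite -(tw i) -(tw l) !inner_lincomb2.
have ny i : nrm (y i) ^+ 2 = nrm (w i) ^+ 2.
  by rewrite -!ripxx /rip yy.
have fgw i : nrm (g i) ^+ 2 + nrm (w i) ^+ 2 = 1.
  by rewrite addrC -nrmD2_orth// -fE (orthonormal_family_nrm i fo) expr1n.
have w1 i : nrm (w i) <= 1.
  rewrite -(@ler_pXn2r _ 2) ?nnegrE ?nrm_ge0// expr1n -(fgw i).
  by rewrite lerDr sqr_ge0.
have y1 i : nrm (y i) <= 1.
  rewrite -(@ler_pXn2r _ 2) ?nnegrE ?nrm_ge0// expr1n ny -(fgw i).
  by rewrite lerDr sqr_ge0.
exists (fun i => g i + y i); split.
  move=> i l; rewrite -fo innerDl !innerDr yy y_orth//.
  rewrite (proj1 (inner_eq0C _ _) (y_orth l (g i) _))// addr0 add0r.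
  rewrite [in RHS](fE i) [in RHS](fE l) [RHS]innerDl.
  rewrite [inner (w i) (_ + _)]innerDr [inner (g i) (_ + _)]innerDr.
  by rewrite wg (proj1 (inner_eq0C _ _) (wg l i)) addr0 add0r addrC.
(* The cross term vanishes, and the form at [y i] is at least [a |w i|^2 - e = a (1 - |g i|^2) - e].
   Adding the form at [g i] gives the form of [T] at [f i] plus [a - e]. *)
move=> i; rewrite TE -/(g i) (rip_split _ _ sS).
have -> : rip (S (g i)) (y i) = 0.
  by rewrite ripC /rip y_orth.
have Sy : nrm (S (y i) - a%:C *: y i) <= e.
  have -> : S (y i) - a%:C *: y i =
      \sum_j inner (w i) (t j) *: (S (v j) - a%:C *: v j).
    rewrite bop_sum scaler_sumr -sumrB; apply: eq_bigr => j _.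
    by rewrite bopZ scalerBr !scalerA mulrC.
  apply: le_trans (ler_nrm_sum _ _ _) _.
  apply: (@le_trans _ _ (\sum_(j < n) e / (n%:R + 1))).
    apply: ler_sum => j _; rewrite nrmZ -[leRHS]mul1r.
    apply: ler_pM; [exact: cabs_ge0|exact: nrm_ge0| |exact: (ltW (v0d j))].
    rewrite -[leLHS]/(cabs _) -lecR -cabsE.
    apply: le_trans (CauchySchwarz_hilbert _ _) _.
    by rewrite !nrmE -rmorphM lecR (orthonormal_family_nrm j to) mulr1.
  rewrite sumr_const card_ord -[leLHS]mulr_natl mulrCA ler_piMr ?(ltW e0)//.
  by rewrite ler_pdivrMr// mul1r lerDl.
have h1 : - e <= rip (S (y i) - a%:C *: y i) (y i).
  have := ler_rip (S (y i) - a%:C *: y i) (y i).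
  rewrite ler_norml => /andP[h _]; apply: le_trans h; rewrite lerN2.
  by rewrite -[leRHS]mulr1; apply: ler_pM => //; exact: nrm_ge0.
move: h1; rewrite ripBl ripZl ripxx ny.
have -> : nrm (w i) ^+ 2 = 1 - nrm (g i) ^+ 2 by have := fgw i; lra.
lra.
Qed.

(** One inequality is termwise, the other is [dilation]. Keeping [T] and [P] abstract lets it serve
    for [S] with its upper part and for [- S] with minus the lower part. *)
Lemma U_upper_part : (forall x, rip (S x) x - a * nrm x ^+ 2 <= rip (T x) x) ->
  U k S = U k T + k%:R * a.
Proof.
move=> hT; apply/eqP; rewrite eq_le; apply/andP; split.
  apply: (U_le sepH infH) => f fo.
  apply: (@le_trans _ _ (\sum_(i < k) (rip (T (f i)) (f i) + a))).
    apply: ler_sum => i _; rewrite -lerBlDr; apply: le_trans (hT (f i)).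
    by rewrite (orthonormal_family_nrm i fo) expr1n mulr1.
  rewrite big_split/= sumr_const card_ord -[a *+ k]mulr_natl lerD2r.
  exact: U_ge.
rewrite -lerBrDr; apply: (U_le sepH infH) => f fo.
apply/ler_addgt0Pr => e e0.
have k0 : 0 < k%:R + 1 :> R by rewrite ltr_wpDl.
have [h [ho hh]] := dilation fo (divr_gt0 e0 k0).
rewrite addrAC lerBrDr; apply: (@le_trans _ _ (\sum_i rip (S (h i)) (h i) + e)); last first.
  by rewrite lerD2r; exact: U_ge.
rewrite -lerBlDr; apply: (@le_trans _ _
    (\sum_(i < k) (rip (T (f i)) (f i) + (a - e / (k%:R + 1))))); last first.
  by apply: ler_sum => i _; rewrite addrA.
rewrite big_split/= sumr_const card_ord -addrA lerD2l -[leRHS]mulr_natl mulrBr.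
rewrite lerD2l lerN2 mulrCA ler_piMr ?(ltW e0)//.
by rewrite ler_pdivrMr// mul1r lerDl.
Qed.

End Dilation.
End Upper_part.

(** * Spectral measures *)

Section Spectrum.
Local Open Scope complex_scope.
Context {R : realType} {H : hilbertType R}.
Implicit Types (x y z : H) (S T : bounded_op H) (t : R).

(** For [|t| > |S|], the operator [sg t (t - S)] is coercive with constant [|t| - |S|], hence
    invertible. *)
Lemma spectrum_bounded S t : spectrum S t%:C -> selfadjoint S -> `|t| <= op_norm S.
Proof.
move=> + sS; apply: contra_notT; rewrite -ltNge => St.
have [I IE] := @bop_id _ H; pose s := Num.sg t.
have t0 : t != 0.
  by apply: contraTneq St => ->; rewrite normr0 -leNgt op_norm_ge0.
have s2 : s * s = 1 by rewrite -expr2 sqr_sg t0.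
have [A AE0] := bop_lincomb I S (s * t)%:C (- s)%:C.
have AE x : A x = - s%:C *: (S x - t%:C *: x).
  by rewrite AE0 IE rmorphN rmorphM/= scalerBr addrC -scalerA !scaleNr opprK.
have [||T [TA AT]] := @lax_milgram _ _ A (`|t| - op_norm S).
- by rewrite subr_gt0.
- move=> x; rewrite AE0 IE ripDl !ripZl ripxx /s -normrEsg mulrBl lerD2l mulNr lerN2.
  apply: le_trans (ler_norm _) _; rewrite normrM normr_sg t0 mul1r.
  apply: le_trans (ler_rip _ _) _; rewrite expr2 mulrA.
  by rewrite ler_wpM2r ?nrm_ge0// nrm_le_op_norm.
have [T' T'E] := bop_lincomb T I (- s)%:C 0.
have {}T'E x : T' x = - s%:C *: T x by rewrite T'E scale0r addr0 rmorphN.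
exists T'; split => x.
  by rewrite T'E -bopZ -AE TA.
rewrite T'E bopZ (scalerA t%:C) (mulrC t%:C) -scalerA -scalerBr -AE; exact: AT.
Qed.

(** If [T] inverts [S - t] with bound [M], then for [|t - r| < (2 M)^-1] the operator [S - r] is
    bounded below, and it is onto because [x = T (y + (r - t) x)] has a solution. Closedness makes
    the spectrum measurable. *)
Lemma spectrum_closed S : closed [set t : R | spectrum S t%:C].
Proof.
rewrite -[X in closed X]setCK; apply: open_closedC; rewrite openE => t /=.
move=> /contrapT[T [TS ST]]; have [M M0 hM] := bop_bound T.
have d0 : 0 < (2 * M)^-1 by rewrite invr_gt0 mulr_gt0.
exists (2 * M)^-1 => //= r; rewrite /ball/= => tr.
have [I IE] := @bop_id _ H; have [A AE0] := bop_lincomb S I 1 (- r%:C).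
have AE x : A x = S x - r%:C *: x by rewrite AE0 IE scale1r scaleNr.
suff [V [VA AV]] : exists V : bounded_op H, (forall x, V (A x) = x) /\ (forall x, A (V x) = x).
  apply; exists V; split => x; first by rewrite -AE.
  by rewrite -AE.
have tM : M * `|t - r| <= 1 / 2.
  have : M * `|t - r| <= M * (2 * M)^-1 by rewrite ler_wpM2l// ltW.
  by have -> : M * (2 * M)^-1 = 1 / 2 by field; rewrite gt_eqF.
apply: (@bijective_bop_inverse _ _ _ (2 * M)^-1) => // [x|y].
  rewrite ler_pdivrMl ?mulr_gt0//.
  have h1 : nrm x <= M * nrm (S x - t%:C *: x) by rewrite -{1}(TS x).
  have h2 : nrm (S x - t%:C *: x) <= nrm (A x) + `|t - r| * nrm x.
    have -> : S x - t%:C *: x = A x - (t - r)%:C *: x.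
      by rewrite AE -addrA -opprD -scalerDl -rmorphD/= [r + _]addrC subrK.
    by apply: le_trans (ler_nrmB _ _) _; rewrite nrmZr.
  have h3 : M * nrm (S x - t%:C *: x) <= M * nrm (A x) + M * `|t - r| * nrm x.
    by rewrite -mulrA -mulrDr ler_wpM2l// ltW.
  have h4 : M * `|t - r| * nrm x <= 1 / 2 * nrm x by rewrite ler_wpM2r ?nrm_ge0.
  lra.
have [||x xE] := @contraction_fixed_point _ _ (fun x => T (y + (r - t)%:C *: x)) (1 / 2).
- by rewrite divr_ge0//= ltr_pdivrMr// mul1r ltr1n.
- move=> x z; rewrite -bopB opprD addrACA subrr add0r -scalerBr.
  apply: le_trans (hM _) _; rewrite nrmZr mulrA distrC.
  by rewrite ler_wpM2r ?nrm_ge0.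
exists x; have := ST (y + (r - t)%:C *: x); rewrite xE AE => h.
have -> : S x - r%:C *: x = S x - t%:C *: x - (r - t)%:C *: x.
  by rewrite -addrA -opprD -scalerDl -rmorphD/= subrKC.
by rewrite h addrK.
Qed.

End Spectrum.

(** * Quadratic forms cut by spectral projections *)

Section Spectral_cut.
Local Open Scope complex_scope.
Context {R : realType} {H : hilbertType R}.
Variables (S : bounded_op H) (E : spectral_measure H).
Hypotheses (sS : selfadjoint S) (SE : is_spectral_measure_of S E).
Implicit Types (x y z : H) (t c B : R) (A D N : set R).

Local Notation sigma := [set t : R | spectrum S t%:C].
Local Notation mu := (scalar_measure E).

Lemma spectrum_measurable : measurable sigma.
Proof. by apply: closed_measurable; exact: spectrum_closed. Qed.

Lemma scalar_measure_proj x A : measurable A -> mu x A = (nrm (E A x) ^+ 2)%:E.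
Proof.
move=> mA; rewrite scalar_measureE//; have [PP sP] := sm_projP E mA.
by rewrite -{1}PP sP innerxx.
Qed.

Lemma scalar_measure_lty x A : measurable A -> (mu x A < +oo)%E.
Proof. by move=> mA; rewrite scalar_measure_proj// ltry. Qed.

Lemma scalar_measure_compl x : mu x (~` sigma) = 0.
Proof.
have ms := spectrum_measurable; have mc := measurableC ms.
rewrite scalar_measure_proj//.
suff -> : E (~` sigma) x = 0 by rewrite nrm0 expr0n.
by rewrite -(SE.1 x) -sm_setI// setICl sm_set0.
Qed.

Lemma scalar_measure_cut x D A : measurable D -> measurable A -> A `<=` D ->
  mu (E D x) A = mu x A.
Proof.
move=> mD mA AD; rewrite !scalar_measure_proj//; congr (nrm _ ^+ 2)%:E.
by rewrite -sm_setI// setIidl.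
Qed.

Lemma scalar_measure_cut_compl x D : measurable D -> mu (E D x) (~` D) = 0.
Proof.
move=> mD; rewrite scalar_measure_proj; last exact: measurableC.
by rewrite -sm_setI//; [rewrite setICl sm_set0 nrm0 expr0n|exact: measurableC].
Qed.

Lemma scalar_integrable x D c : measurable D -> (exists B, D `<=` `[- B, B]) ->
  (mu x).-integrable D (EFin \o (fun t => t - c)).
Proof.
move=> mD [B DB]; apply: measurable_bounded_integrable => //.
- exact: scalar_measure_lty.
- exact: measurable_funB.
- exists (`|B| + `|c|); split; first by rewrite num_real.
  move=> M BM t /DB; rewrite /= in_itv/= -ler_norml => tB.
  apply: le_trans (ltW BM); apply: le_trans (ler_normB _ _) _.
  by rewrite lerD2r; apply: le_trans tB (ler_norm _).
Qed.

Lemma scalar_Rintegral_null x D N c : measurable D -> (exists B, D `<=` `[- B, B]) ->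
  measurable N -> mu x N = 0 ->
  \int[mu x]_(t in D) (t - c) = \int[mu x]_(t in D `\` N) (t - c).
Proof.
move=> mD DB mN N0; rewrite /Rintegral; congr fine.
by apply: negligible_integral => //; exact: scalar_integrable.
Qed.

Lemma scalar_Rintegral_le0 x D c : measurable D -> (exists B, D `<=` `[- B, B]) ->
  (forall t, D t -> t <= c) -> \int[mu x]_(t in D) (t - c) <= 0.
Proof.
move=> mD DB Dc; have iD := scalar_integrable x c mD DB.
have := le_Rintegral mD iD (integrable0 _ D).
rewrite /= Rintegral_cst// mul0r; apply => t Dt; rewrite subr_le0; exact: Dc.
Qed.

Lemma spectrum_itv : exists B, sigma `<=` `[- B, B].
Proof.
exists (op_norm S) => t /= St.
by rewrite in_itv/= -ler_norml spectrum_bounded.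
Qed.

Lemma form_spectral x c :
  rip (S x) x - c * nrm x ^+ 2 = \int[mu x]_(t in sigma) (t - c).
Proof.
have ms := spectrum_measurable; have [B sB] := spectrum_itv.
rewrite /rip SE.2/= RintegralB//; last 2 first.
- have := @scalar_integrable x sigma 0 ms (ex_intro _ B sB).
  by rewrite (_ : (fun t => t - 0) = id)//; apply/funext => t; rewrite subr0.
- apply: measurable_bounded_integrable => //.
    exact: scalar_measure_lty.
  exists `|c|; split; first by rewrite num_real.
  by move=> M cM t _; exact: ltW.
rewrite Rintegral_cst//; congr (_ - _ * _).
by have /(congr1 fine)/= := scalar_measure_proj x ms; rewrite SE.1 => <-.
Qed.

(** The scalar measure of [E D x] is that of [x] restricted to [D]. After discarding null sets, both
    integrals are over the part of the spectrum inside [D]. *)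
Lemma form_spectral_cut x c D : measurable D -> (exists B, D `<=` `[- B, B]) ->
  rip (S (E D x)) (E D x) - c * nrm (E D x) ^+ 2 = \int[mu x]_(t in D) (t - c).
Proof.
move=> mD DB; have ms := spectrum_measurable.
have mD' := measurableC mD; have ms' := measurableC ms.
rewrite form_spectral (scalar_Rintegral_null _ ms spectrum_itv mD'); last first.
  exact: scalar_measure_cut_compl.
rewrite (scalar_Rintegral_null _ mD DB ms'); last exact: scalar_measure_compl.
rewrite !setDE !setCK setIC /Rintegral; congr fine.
by apply: eq_measure_integral => A mA AD; apply: scalar_measure_cut => // t /AD[].
Qed.

(** [spectral_integral] is chosen by [xget], so a witness is required: [E(D) (S - c) E(D)]. *)
Lemma spectral_integral_cut D c : measurable D -> (exists B, D `<=` `[- B, B]) ->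
  is_spectral_integral E D (fun t => t - c) (spectral_integral E D (fun t => t - c)).
Proof.
move=> mD DB; apply: xgetPex; have [PP sP] := sm_projP E mD.
have [I IE] := @bop_id _ H.
have [A AE0] := bop_lincomb S I 1 (- c)%:C.
have [B BE] := bop_comp A (E D); have [T TE] := bop_comp (E D) B.
exists T => x; rewrite -form_spectral_cut// TE BE AE0 IE sP scale1r.
rewrite innerDl innerZl selfadjoint_form_real// innerxx.
by rewrite -rmorphM -rmorphD/= mulNr.
Qed.

Lemma rip_spectral_integral x D c : measurable D -> (exists B, D `<=` `[- B, B]) ->
  rip (spectral_integral E D (fun t => t - c) x) x =
  rip (S (E D x)) (E D x) - c * nrm (E D x) ^+ 2.
Proof. by move=> mD DB; rewrite /rip spectral_integral_cut// form_spectral_cut. Qed.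

(** The sign of the leftover integral decides which way the form of [S - c] compares with that of
    its cut. *)
Lemma form_spectral_split x D c : measurable D -> (exists B, D `<=` `[- B, B]) ->
  rip (S x) x - c * nrm x ^+ 2 =
  rip (spectral_integral E D (fun t => t - c) x) x +
  \int[mu x]_(t in sigma `\` D) (t - c).
Proof.
move=> mD DB; rewrite /rip spectral_integral_cut//= -/(rip _ _) form_spectral.
have ms := spectrum_measurable; have ms' := measurableC ms.
rewrite (scalar_Rintegral_null _ mD DB ms'); last exact: scalar_measure_compl.
rewrite setDE setCK -[in LHS](setDUK (@subIsetr _ D sigma)) Rintegral_setU//.
- by rewrite setDIr setDv setU0.
- exact: measurableI.
- by apply: measurableD => //; exact: measurableI.
- rewrite setDUK; last exact: subIsetr.
  exact: scalar_integrable ms spectrum_itv.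
- by apply/disj_set2P; rewrite setDE setICA setICr setI0.
Qed.

End Spectral_cut.

(** The essential norm is the larger of [alpha_plus S] and [- alpha_minus S], so it differs from
    [alpha_plus S] for instance when [S] is minus the identity. The equality is therefore stated
    with the exact condition under which it holds. *)
Theorem proposition3p5 (R : realType) (H : hilbertType R)
    (sepH : separable_hilbert H) (infH : infinite_dimensional H)
    (S : bounded_op H) (saS : selfadjoint S) :
  (forall (E : spectral_measure H), is_spectral_measure_of S E ->
   forall k : nat, (0 < k)%N ->
     U k S = U k (upper_part S E) + k%:R * alpha_plus S /\
     L k S = L k (lower_part S E) + k%:R * alpha_minus S) /\
  ((fun k : nat => U k S / k%:R) @ \oo --> alpha_plus S) /\
  (alpha_plus S = essential_norm S <-> - alpha_minus S <= alpha_plus S) /\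
  ((fun k : nat => L k S / k%:R) @ \oo --> alpha_minus S).
Proof.
have [a tS] := ess_top_exists infH S.
have [N NE] := bop_opp S.
have sN : selfadjoint N by move=> x y; rewrite !NE innerNl innerNr saS.
have [b tN] := ess_top_exists infH N.
have aE := alpha_plusE saS tS; have bE := alpha_minusE saS NE tN.
have LS k : L k S = - U k N := LE sepH infH k NE.
have itv_bounded (u v : R) : exists B, `[u, v]%classic `<=` `[- B, B]%classic.
  exists (`|u| + `|v|) => t /=; rewrite !in_itv/= => /andP[ut tv].
  have := ler_norm v; have := ler_norm (- u); rewrite normrN => hu hv.
  have := normr_ge0 u; have := normr_ge0 v => v0 u0; apply/andP; split; lra.
split; last split; last split.
- move=> E SE k _; split.
    set D := `[alpha_plus S, op_norm S]%classic.
    have mD : measurable D by exact: measurable_itv.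
    have DB := itv_bounded (alpha_plus S) (op_norm S).
    rewrite aE; apply: (U_upper_part sepH infH _ saS tS (sm_projP E mD)) => x.
      by rewrite /upper_part -/D (rip_spectral_integral saS SE)// aE.
    rewrite -aE (form_spectral_split saS SE _ _ mD DB) gerDl.
    have ms := spectrum_measurable S; have [B sB] := spectrum_itv saS.
    apply: scalar_Rintegral_le0; [exact: measurableD|by exists B => t [/sB]|].
    (* The spectrum lies in [[- |S|, |S|]], so a point of it outside [D] can only be below
       [alpha_plus S]. *)
    move=> t [/= St nD]; rewrite leNgt; apply/negP => ta.
    apply: nD; rewrite /D/= in_itv/= (ltW ta)/=.
    exact: le_trans (ler_norm _) (spectrum_bounded St saS).
  set D := `[- op_norm S, alpha_minus S]%classic.
  have mD : measurable D by exact: measurable_itv.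
  have DB := itv_bounded (- op_norm S) (alpha_minus S).
  (* Since [alpha_minus S = - b], the operator [T] has the form of [P (N - b) P] with [P = E D]:
     minus the lower part of [S] acts as an upper part of [N = - S]. *)
  have [T TE] := bop_opp (lower_part S E).
  rewrite LS (LE sepH infH k TE) bE mulrN -opprD; congr (- _).
  apply: (U_upper_part sepH infH _ sN tN (sm_projP E mD)) => x.
    rewrite TE ripNl /lower_part -/D (rip_spectral_integral saS SE)// bE NE ripNl.
    by rewrite opprB addrC mulNr.
  rewrite TE NE !ripNl; have := form_spectral_split saS SE x (alpha_minus S) mD DB.
  rewrite -/(lower_part S E) {1}bE.
  pose sigma := [set t : R | spectrum S (real_complex R t)].
  suff : 0 <= \int[scalar_measure E x]_(t in sigma `\` D) (t - alpha_minus S) by lra.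
  apply: Rintegral_ge0 => t [/= St nD]; rewrite subr_ge0 leNgt; apply/negP => ta.
  apply: nD; rewrite /D/= in_itv/= (ltW ta) andbT.
  by have := spectrum_bounded St saS; rewrite ler_norml => /andP[].
- by rewrite aE; exact: U_cvg.
- rewrite (essential_normE infH saS NE tS tN) aE bE opprK.
  by split => [->|ba]; [rewrite le_max lexx orbT|rewrite max_l].
- rewrite bE; under eq_fun do rewrite LS mulNr.
  by apply: cvgN; exact: U_cvg.
Qed.
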